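(* Fix a real number $c \ge 1$. For positive integers $n$ such that $cn$ is an integer, put $p = n$ and $q = cn$, and let $X_{p,q}$ be the random variable whose law is $$\mathbb{P}(X_{p,q} = k) \;=\; \frac{u((p,q),k)}{\sum_{j \ge 0} u((p,q),j)}, \qquad k = 0,1,2,\dots,$$ i.e. $X_{p,q}$ is the length of an unrestricted generalized jump path starting at $(p,q)$ chosen uniformly at random. Set $$\mu_{p,q} = \frac{p+q+\sqrt{p^2+6pq+q^2}}{4}, \qquad \sigma_{p,q}^2 = \frac{p+q}{8} + \frac{(p+q)^2}{8\sqrt{p^2+6pq+q^2}}.$$ Then, as $n \to \infty$, $(X_{p,q} - \mu_{p,q})/\sigma_{p,q}$ converges in distribution to a standard normal random variable. In other words, $X_{p,q}$ is asymptotically Gaussian with mean $\mu_{p,q}$ and variance $\sigma^2_{p,q}$.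
   Context: Let $\mathbb{N} = \{0,1,2,\dots\}$ and let $d \ge 1$. For $v \in \mathbb{N}^d$ and $n \in \mathbb{N}$, an unrestricted generalized jump path of length $n$ starting at $v$ is a sequence $(x_0, x_1, \dots, x_n)$ of points of $\mathbb{N}^d$ satisfying three conditions: - $x_0 = v$; - for every $i$, each coordinate of $x_{i+1}$ is at most the corresponding coordinate of $x_i$; - $x_{i+1} \neq x_i$ for every $i$. Let $u(v,n)$ denote the number of such paths. In dimension $d = 2$ we write $u((p,q),n)$. *)

(* Defs.v *)
From mathcomp Require Import all_boot.
Set Implicit Arguments.
Unset Strict Implicit.
Unset Printing Implicit Defensive.

(* A candidate path of length k starting at (p,q) is a function
   x : {0..k} -> {0..p} x {0..q}.  Since the first point is (p,q) and the
   coordinates are non-increasing, every point of a path automatically lies in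
   {0..p} x {0..q}, so this bounded carrier loses nothing. *)
Definition jump_path (p q k : nat)
    (x : {ffun 'I_k.+1 -> 'I_p.+1 * 'I_q.+1}) : bool :=
  [&& nat_of_ord (x ord0).1 == p,
      nat_of_ord (x ord0).2 == q &
      [forall i : 'I_k,
        let xi  := x (widen_ord (leqnSn k) i) in
        let xi1 := x (lift ord0 i) in
        [&& nat_of_ord xi1.1 <= nat_of_ord xi.1,
            nat_of_ord xi1.2 <= nat_of_ord xi.2 &
            xi1 != xi]]].

Arguments jump_path : clear implicits.

Definition u (p q k : nat) : nat := #|[pred x | jump_path p q k x]|.

From Stdlib Require Import Reals.
Local Open Scope R_scope.

(* Total number of paths starting at (p,q): sum_{j>=0} u((p,q),j).
   Each step strictly decreases p+q, so u((p,q),j) = 0 for j > p+q and the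
   sum is the finite sum over j = 0..p+q. *)
Definition total_paths (p q : nat) : R :=
  sum_f_R0 (fun j => INR (u p q j)) (p + q).

Definition prob_X (p q k : nat) : R := INR (u p q k) / total_paths p q.

Definition cdf_normalized (p q : nat) (m s t : R) : R :=
  sum_f_R0 (fun k => if Rle_dec ((INR k - m) / s) t then prob_X p q k else 0)
           (p + q).

Definition mu_pq (p q : R) : R :=
  (p + q + sqrt (p ^ 2 + 6 * p * q + q ^ 2)) / 4.

Definition sigma2_pq (p q : R) : R :=
  (p + q) / 8 + (p + q) ^ 2 / (8 * sqrt (p ^ 2 + 6 * p * q + q ^ 2)).

Definition gauss (t : R) : R := exp (- (t ^ 2) / 2).

Lemma gauss_continuous : continuity gauss.
Proof.
  unfold gauss. apply continuity_comp with (f1 := fun t => - t ^ 2 / 2).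
  - apply continuity_mult.
    + apply continuity_opp. apply derivable_continuous.
      apply derivable_pow.
    + apply continuity_const. intros a b; reflexivity.
  - apply derivable_continuous, derivable_exp.
Qed.

Lemma gauss_integrable (x : R) : Riemann_integrable gauss 0 x.
Proof.
  destruct (Rle_dec 0 x) as [H|H].
  - apply continuity_implies_RiemannInt; [exact H|].
    intros y _; apply gauss_continuous.
  - apply RiemannInt_P1. apply continuity_implies_RiemannInt.
    + left; apply Rnot_le_lt; exact H.
    + intros y _; apply gauss_continuous.
Qed.

Definition Phi (x : R) : R :=
  / 2 + / sqrt (2 * PI) * RiemannInt (gauss_integrable x).

(* Main.v *)
(* The generating function 1 / (1 - (1+t)(x + y - x y)) gives
   u((p,q),k) = sum_j C(p,j) C(q,j) C(N-j,k-j) with N = p + q, so X is the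
   second coordinate of a pair (J, X) whose joint law has explicit weights. The ratios of neighbouring weights yield two identities,
     E[(X-J) g(J,X-1)] = E[(N-X) g(J,X)],
     E[J^2 (N-J+1) g(J,X)] = E[(p-J)(q-J)(X-J) g(J+1,X)].
   With j0 the positive root of j^2 + N j = p q and mu = (N+j0)/2, they give
   E(J-j0)^2 = O(N) and E(X-mu)^2 = O(N). For g a function of X alone, the second
   one linearizes to E[(J-j0) g(X)] = kappa E[(X-mu) g(X)] + O(1) and the first one
   then becomes, for W = (X-mu)/sigma, Stein's identity
   E[F'(W) - W F(W)] = O(1/sqrt N). Taking F(w) = e^(w^2/2) int_{-oo}^w psi e^(-s^2/2) ds
   with psi Lipschitz, compactly supported and of Gaussian mean 0 gives E psi(W) -> 0;
   trapezoidal test functions and Chebyshev's inequality finish the proof. *)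
Require Import Defs.
From mathcomp Require all_boot zify.
From Stdlib Require Import Reals Lra Lia Psatz.
From Coquelicot Require Import Coquelicot.
Local Open Scope R_scope.

(** * Counting jump paths *)

(* ssrnat's notations are confined to this module, since [<=] on [nat] in the
   theorem is Stdlib's. *)
Module Counting.
Import all_boot zify.
Local Open Scope nat_scope.

(** Deleting the first point is a bijection from the chains with [k.+1] steps at [x] onto the chains
    with [k] steps at the [e]-successors of [x]; [cons x] is its inverse. *)
Lemma card_chains_rec (T : finType) (e : rel T) (k : nat) (x : T) :
  let chains k x := [pred f : {ffun 'I_k.+1 -> T} | (f ord0 == x) &&
    [forall i : 'I_k, e (f (widen_ord (leqnSn k) i)) (f (lift ord0 i))]] in
  #|chains k.+1 x| = \sum_(y | e x y) #|chains k y|.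
Proof.
move=> chains.
pose cons z (g : {ffun 'I_k.+1 -> T}) : {ffun 'I_k.+2 -> T} :=
  [ffun i => oapp g z (unlift ord0 i)].
have cons0 z g : cons z g ord0 = z by rewrite ffunE unlift_none.
have consS z g i : cons z g (lift ord0 i) = g i by rewrite ffunE liftK.
pose tl (f : {ffun 'I_k.+2 -> T}) : {ffun 'I_k.+1 -> T} := [ffun i => f (lift ord0 i)].
have consK (f : {ffun 'I_k.+2 -> T}) : cons (f ord0) (tl f) = f.
  apply/ffunP=> i; rewrite ffunE; case: unliftP => [j|] -> //=; by rewrite ffunE.
have tlK z g : tl (cons z g) = g by apply/ffunP=> i; rewrite ffunE consS.
have chains_cons z g : (cons z g \in chains k.+1 x) =
    [&& z == x, e z (g ord0) & g \in chains k (g ord0)].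
  rewrite !inE cons0 eqxx /=; congr (_ && _).
  apply/forallP/andP => [H|[H0 /forallP H] i].
  - split.
      by have := H ord0; rewrite consS (_ : widen_ord _ _ = ord0) ?cons0 //; apply: val_inj.
    apply/forallP=> i; have := H (lift ord0 i); rewrite consS.
    by rewrite (_ : widen_ord _ _ = lift ord0 (widen_ord (leqnSn k) i)) ?consS //; apply: val_inj.
  - rewrite consS; case: (unliftP ord0 i) => [j|] ->.
      by rewrite (_ : widen_ord _ _ = lift ord0 (widen_ord (leqnSn k) j)) ?consS //; apply: val_inj.
    by rewrite (_ : widen_ord _ _ = ord0) ?cons0 //; apply: val_inj.
rewrite -sum1_card (reindex (fun g => cons x g)); last first.
  exists tl => [g _|f]; first exact: tlK.
  by rewrite inE => /andP[/eqP <- _].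
under eq_bigl => g do rewrite chains_cons eqxx andTb.
rewrite (partition_big (fun g : {ffun 'I_k.+1 -> T} => g ord0) (e x)) /=; last first.
  by move=> g /andP[].
apply: eq_bigr => y exy; rewrite -sum1_card; apply: eq_bigl => g.
rewrite !inE eqxx /=; case: eqP => [->|_]; last by rewrite andbF.
by rewrite exy andbT.
Qed.

(** The test guards against truncated subtraction: for [k < j] the bare binomial would be 1 instead
    of 0. *)
Definition coeff (N k j : nat) : nat := if j <= k then 'C(N - j, k - j) else 0.

Lemma coeffS N k j : j <= N -> coeff N.+1 k.+1 j = coeff N k.+1 j + coeff N k j.
Proof.
rewrite /coeff => jN; case: (ltngtP j k.+1) => [jk|jk|->].
- have jk' : j <= k by lia.
  by rewrite jk' subSn // subSn // binS.
- by rewrite ifN //; lia.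
- by rewrite subnn !bin0 ltnn.
Qed.

Lemma coeffSS N k j : coeff N.+1 k.+1 j.+1 = coeff N k j.
Proof. by rewrite /coeff ltnS !subSS. Qed.

Definition paths (p q k : nat) : nat :=
  \sum_(0 <= j < (p + q).+1) 'C(p, j) * 'C(q, j) * coeff (p + q) k j.

Lemma paths_widen p q k M : p + q <= M ->
  paths p q k = \sum_(0 <= j < M.+1) 'C(p, j) * 'C(q, j) * coeff (p + q) k j.
Proof.
move=> le; rewrite /paths [RHS](@big_cat_nat _ _ _ (p + q).+1) //=.
rewrite [X in _ = _ + X]big_nat_cond [X in _ = _ + X]big1 ?addn0 // => j.
by case/andP=> /andP[lj _] _; rewrite (bin_small (n := p)) //; lia.
Qed.

(* The coefficient form of P(p+1,q+1) = (1+t) (P(p,q+1) + P(p+1,q) - P(p,q)), where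
   P(p,q) = sum_k paths p q k t^k, i.e. of the bivariate generating function
   1 / (1 - (1+t) (x + y - x y)). *)
Lemma paths_step p q k :
  paths p.+1 q.+1 k.+1 + paths p q k.+1 + paths p q k =
  paths p q.+1 k.+1 + paths p.+1 q k.+1 + (paths p q.+1 k + paths p.+1 q k).
Proof.
pose M := (p + q).+3.
rewrite !(@paths_widen _ _ _ M); try by rewrite /M; lia.
rewrite -!addnA -!big_split /=.
pose c j := 'C(p, j) * 'C(q, j).
(* Pascal's rule splits off [coeff (p + q).+1 k j], which equals [coeff (p + q).+2 k.+1 j.+1]; hence
   the second sum, where the index of [c] is shifted by one. *)
have E1 : \sum_(0 <= j < M.+1) c j * coeff (p + q).+2 k.+1 j =
    \sum_(0 <= j < M.+1) (c j * coeff (p + q).+1 k.+1 j) +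
    \sum_(0 <= j < M.+1) (if j is i.+1 then c i else 0) * coeff (p + q).+2 k.+1 j.
  rewrite [X in _ = _ + X]big_nat_recl //= mul0n add0n.
  under [X in _ = _ + X]eq_bigr => j _ do rewrite coeffSS.
  rewrite [LHS]big_nat_recr //= [X in _ = X + _]big_nat_recr //=.
  rewrite /c (bin_small (m := M)) /M; last by lia.
  rewrite !mul0n !addn0 -big_split /=; apply: eq_big_nat => j /andP[_ jM].
  case: (leqP j (p + q).+1) => jN; first by rewrite coeffS // mulnDr.
  by rewrite (bin_small (n := p)) ?mul0n //; lia.
pose S2 := \sum_(0 <= j < M.+1) c j * coeff (p + q).+1 k.+1 j.
pose S3 := \sum_(0 <= j < M.+1) ('C(p.+1, j) * 'C(q.+1, j)) * coeff (p + q).+2 k.+1 j.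
pose S4 := \sum_(0 <= j < M.+1) ('C(p.+1, j) * 'C(q, j) + 'C(p, j) * 'C(q.+1, j)) * coeff (p + q).+2 k.+1 j.
transitivity (S3 + S2).
  rewrite /S3 /S2 -big_split /=; apply: eq_bigr => j _.
  rewrite addSn addnS /c; congr (_ + _).
  case: (leqP j (p + q)) => jN; first by rewrite coeffS // mulnDr.
  by rewrite (bin_small (n := p)) ?mul0n //; lia.
transitivity S4; last first.
  rewrite /S4; apply: eq_bigr => j _; rewrite addSn addnS.
  case: (leqP j (p + q).+1) => jN; first by rewrite coeffS //; lia.
  by rewrite (bin_small (n := p)) 1?(bin_small (n := q)) ?mul0n ?muln0 //; lia.
(* Termwise this is (a + a')(b + b') + a b = (a + a') b + a (b + b') + a' b', with a, b the
   binomials at [j.+1] and a', b' those at [j]. *)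
have E2 : S3 + \sum_(0 <= j < M.+1) c j * coeff (p + q).+2 k.+1 j = S4 +
   \sum_(0 <= j < M.+1) (if j is i.+1 then c i else 0) * coeff (p + q).+2 k.+1 j.
  rewrite /S3 /S4 -!big_split /=; apply: eq_bigr => j _.
  rewrite -!mulnDl; congr (_ * _); rewrite /c.
  by case: j => [|j]; rewrite ?bin0 // !binS; lia.
move: E2; rewrite E1 -/S2; lia.
Qed.

Lemma paths0l q k : paths 0 q k = 'C(q, k).
Proof.
rewrite /paths big_nat_recl // big_nat_cond big1 ?addn0; last by move=> j _; rewrite bin0n mul0n.
by rewrite !bin0 !mul1n /coeff /= !subn0.
Qed.

Lemma paths0r p k : paths p 0 k = 'C(p, k).
Proof.
rewrite -(paths0l p k) /paths addn0; apply: eq_bigr => j _.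
by rewrite (mulnC 'C(p, j)).
Qed.

(** The first-step recursion: the corner [(p, q)] of the rectangle contributes [paths p q k], the
    other points are the possible first jumps. [paths_step] telescopes along each row, then over the
    rows. *)
Lemma paths_rectangle p q k :
  \sum_(0 <= a < p.+1) \sum_(0 <= b < q.+1) paths a b k = paths p q k.+1 + paths p q k.
Proof.
have row0 r : \sum_(0 <= b < r.+1) paths 0 b k = paths 0 r k.+1 + paths 0 r k.
  elim: r => [|r IH]; first by rewrite big_nat1 !paths0l bin0n.
  by rewrite big_nat_recr //= IH !paths0l binS.
have row a r : \sum_(0 <= b < r.+1) paths a.+1 b k + (paths a r k.+1 + paths a r k) =
    paths a.+1 r k.+1 + paths a.+1 r k.
  elim: r => [|r IH]; first by rewrite big_nat1 !paths0r binS; lia.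
  by rewrite big_nat_recr //=; have := paths_step a r k; lia.
elim: p => [|p IH]; first by rewrite big_nat1.
by rewrite big_nat_recr //= IH; have := row p q; lia.
Qed.

Lemma paths_at0 p q : paths p q 0 = 1.
Proof.
rewrite /paths big_nat_recl // big1 ?addn0; first by rewrite !bin0 /coeff /= bin0.
by move=> j _; rewrite muln0.
Qed.

(** Jump paths are the chains of the strict product order, so [card_chains_rec] and
    [paths_rectangle] give both counts the same recursion on the length. *)
Lemma u_paths p q k : u p q k = paths p q k.
Proof.
pose T := ('I_p.+1 * 'I_q.+1)%type.
pose e : rel T := fun x y => [&& y.1 <= x.1, y.2 <= x.2 & y != x].
pose chains k x := [pred f : {ffun 'I_k.+1 -> T} | (f ord0 == x) &&
    [forall i : 'I_k, e (f (widen_ord (leqnSn k) i)) (f (lift ord0 i))]].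
have key l x : #|chains l x| = paths x.1 x.2 l.
  elim: l x => [|l IH] x.
    rewrite paths_at0; apply: etrans (card1 [ffun _ : 'I_1 => x]).
    apply: eq_card => f; rewrite !inE.
    rewrite (_ : [forall i, _] = true) ?andbT; last by apply/forallP; case.
    apply/eqP/eqP => [fx|->]; last by rewrite ffunE.
    by apply/ffunP => i; rewrite ffunE -fx ord1.
  have rect : \sum_(y : T | (y.1 <= x.1) && (y.2 <= x.2)) paths y.1 y.2 l =
      paths x.1 x.2 l.+1 + paths x.1 x.2 l.
    rewrite -paths_rectangle.
    rewrite -(pair_big (fun i : 'I_p.+1 => i <= x.1) (fun j : 'I_q.+1 => j <= x.2)
      (fun i j => paths i j l)) /=.
    rewrite big_mkord (big_ord_widen p.+1 (fun a => \sum_(0 <= b < x.2.+1) paths a b l)) ?ltn_ord //.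
    apply: eq_bigr => i _.
    by rewrite big_mkord (big_ord_widen q.+1 (fun b => paths i b l)) ?ltn_ord.
  (* Adding the term of [y = x] completes the strict successors of [x] to a full rectangle. *)
  apply: (@addIn (paths x.1 x.2 l)); rewrite -rect (bigD1 x) ?leqnn //= addnC; congr (_ + _).
  rewrite card_chains_rec; apply: eq_big => [y|y _]; last exact: IH.
  by rewrite /e andbA.
rewrite -(key k (ord_max, ord_max)) /u; apply: eq_card => f; rewrite !inE /jump_path.
rewrite andbA; congr (_ && _).
Qed.

(** * Joint weights and the ratios of neighbouring ones *)

Definition weight (p q j k : nat) : nat := 'C(p, j) * 'C(q, j) * coeff (p + q) k j.

Lemma weight_gt0 p q j k : (0 < weight p q j k) = [&& j <= p, j <= q, j <= k & k <= p + q].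
Proof.
rewrite /weight !muln_gt0 !bin_gt0 /coeff -andbA; case: (leqP j p) => //= jp; congr (_ && _).
case: (leqP j k) => //= jk; by rewrite bin_gt0 leq_sub2rE // (leq_trans jp) // leq_addr.
Qed.

(** This is (m+1) C(n,m+1) = (n-m) C(n,m) with n = p + q - j and m = k - j, written with sums only
    because subtraction truncates. *)
Lemma weight_step_k p q j k :
  k.+1 * weight p q j k.+1 + k * weight p q j k =
  (p + q) * weight p q j k + j * weight p q j k.+1.
Proof.
case: (posnP (weight p q j k)) => [w0|/[!weight_gt0]/and4P[jp jq jk kN]].
  rewrite w0 !muln0 addn0 add0n.
  case: (posnP (weight p q j k.+1)) => [-> |]; first by rewrite !muln0.
  rewrite weight_gt0 => /and4P[jp jq jk kN].
  (* Only the weight at [k.+1] is nonzero here, which forces [j = k.+1]. *)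
  have kj : k < j.
    rewrite ltnNge; apply/negP => kj; move: w0 => /eqP; apply/negP.
    by rewrite -lt0n weight_gt0 jp jq kj ltnW.
  by congr (_ * _); apply/eqP; rewrite eqn_leq kj jk.
rewrite /weight /coeff jk (leq_trans jk) // subSn //.
have := mul_bin_left (p + q - j) (k - j).
set A := 'C(_ - _, _ - _); set B := 'C(_ - _, _.+1) => E.
have -> : k = (k - j) + j by lia.
have E' : (k - j).+1 * B + (k - j) * A = (p + q - j) * A.
  rewrite E -mulnDl; congr (_ * _); lia.
have -> : p + q = (p + q - j) + j by lia.
move: E'; rewrite -/A; set m := k - j; set n := p + q - j.
set c := 'C(p, j) * 'C(q, j) => E'.
nia.
Qed.

(** The product of (j+1) C(p,j+1) = (p-j) C(p,j), the same for [q], and n C(n-1,m-1) = m C(n,m) with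
    n = p + q - j and m = k - j. *)
Lemma weight_step_j p q j k : j <= p -> j <= q -> j <= k ->
  j.+1 ^ 2 * (p + q - j) * weight p q j.+1 k =
  (p - j) * (q - j) * (k - j) * weight p q j k.
Proof.
move=> jp jq jk; rewrite /weight /coeff jk.
have Ep := mul_bin_left p j; have Eq := mul_bin_left q j.
case: (ltnP j k) => [jk'|kj]; last first.
  by rewrite (_ : k - j = 0) ?muln0 //; lia.
have := mul_bin_diag (p + q - j) (k - j).-1.
rewrite (_ : (k - j).-1.+1 = k - j); last by lia.
rewrite (_ : (p + q - j).-1 = p + q - j.+1); last by lia.
rewrite (_ : (k - j).-1 = k - j.+1); last by lia.
move=> Ex.
transitivity ((j.+1 * 'C(p, j.+1)) * (j.+1 * 'C(q, j.+1)) * ((p + q - j) * 'C(p + q - j.+1, k - j.+1))); first by lia.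
rewrite Ep Eq Ex; lia.
Qed.

Lemma u_sum_weight p q k :
  INR (u p q k) = sum_f_R0 (fun j => INR (weight p q j k)) (p + q)%coq_nat.
Proof.
have H n : INR (\sum_(0 <= j < n.+1) weight p q j k) = sum_f_R0 (fun j => INR (weight p q j k)) n.
  elim: n => [|n IH]; first by rewrite big_nat1.
  by rewrite big_nat_recr //= -plusE plus_INR IH.
by rewrite u_paths H.
Qed.


Lemma weight_support_le p q j k : weight p q j k <> 0 ->
  [/\ (j <= p)%coq_nat, (j <= q)%coq_nat, (j <= k)%coq_nat & (k <= p + q)%coq_nat].
Proof.
move/eqP; rewrite -lt0n => /[!weight_gt0]/and4P[H1 H2 H3 H4].
by split; apply/leP.
Qed.

Local Open Scope R_scope.

Lemma weight_step_k_INR p q j k :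
  ((INR k + 1 - INR j) * INR (weight p q j k.+1) =
   (INR (Nat.add p q) - INR k) * INR (weight p q j k)).
Proof.
have := weight_step_k p q j k.
move: (weight p q j k.+1) (weight p q j k) => A B /(congr1 INR).
rewrite -multE -!plusE plus_INR !mult_INR plus_INR !mult_INR !plus_INR S_INR; lra.
Qed.

Lemma weight_step_j_INR p q j k :
  ((INR j + 1) ^ 2 * (INR (Nat.add p q) - INR j) * INR (weight p q j.+1 k) =
   (INR p - INR j) * (INR q - INR j) * (INR k - INR j) * INR (weight p q j k)).
Proof.
case: (posnP (weight p q j k)) => [w0|/[!weight_gt0]/and4P[jp jq jk kN]].
  case: (posnP (weight p q j.+1 k)) => [-> |]; first by rewrite w0 /= !Rmult_0_r.
  move=> /[!weight_gt0]/and4P[jp jq jk kN]; move: w0 => /eqP E; exfalso; move: E; apply/negP.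
  by rewrite -lt0n weight_gt0 (ltnW jp) (ltnW jq) (ltnW jk) kN.
have := weight_step_j _ _ _ _ jp jq jk.
move: (weight p q j.+1 k) (weight p q j k) => A B /(congr1 INR).
rewrite expnS expn1 -multE -minusE -!plusE !mult_INR !minus_INR ?S_INR; last first.
- by apply/leP; rewrite plusE (leq_trans jp) ?leq_addr.
- exact/leP.
- exact/leP.
- exact/leP.
by move=> E; rewrite -E /=; ring.
Qed.

End Counting.

(** * Stein's identity for the joint law *)

(** Test functions take real arguments, so that a shift such as x - 1 at x = 0 is not truncated. *)
Definition Ex (n : nat) (w : nat -> nat -> R) (f : R -> R -> R) : R :=
  sum_f_R0 (fun x => sum_f_R0 (fun j => w j x * f (INR j) (INR x)) n) n.

Lemma Ex_lin n w a f g :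
  Ex n w (fun j x => a * f j x + g j x) = a * Ex n w f + Ex n w g.
Proof.
unfold Ex. rewrite scal_sum, <- sum_plus. apply sum_eq; intros x _.
rewrite Rmult_comm, scal_sum, <- sum_plus. apply sum_eq; intros j _. ring.
Qed.

Lemma Ex_le n w f g : (forall j x, 0 <= w j x) ->
  (forall j x, w j x <> 0 -> f (INR j) (INR x) <= g (INR j) (INR x)) ->
  Ex n w f <= Ex n w g.
Proof.
intros w0 H. unfold Ex. apply sum_Rle; intros x _. apply sum_Rle; intros j _.
destruct (Req_dec (w j x) 0) as [E|E]; [rewrite E; lra|].
apply Rmult_le_compat_l; auto.
Qed.

Lemma Ex_ext n w f g :
  (forall j x, f (INR j) (INR x) = g (INR j) (INR x)) -> Ex n w f = Ex n w g.
Proof.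
intros H. unfold Ex. apply sum_eq; intros x _. apply sum_eq; intros j _.
now rewrite H.
Qed.

Lemma sum_shift (a b : nat -> R) n :
  a 0%nat = 0 -> b n = 0 -> (forall k, a (S k) = b k) -> sum_f_R0 a n = sum_f_R0 b n.
Proof.
intros a0 bn H.
assert (E : forall m, sum_f_R0 a m = sum_f_R0 b m - b m).
{ induction m as [|m IH]; simpl; [lra|]. rewrite IH, H; lra. }
rewrite E; lra.
Qed.

(* [w j x] stands for P(J = j, X = x); [law_step_x] and [law_step_j] are the ratios of
   neighbouring weights C(p,j) C(q,j) C(p+q-j,x-j), cleared of denominators. *)
Record path_law (p q : nat) (w : nat -> nat -> R) : Prop := {
  law_ge0 : forall j x, 0 <= w j x;
  law_support : forall j x, w j x <> 0 -> (j <= p /\ j <= q /\ j <= x /\ x <= p + q)%nat;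
  law_step_x : forall j x,
    (INR x + 1 - INR j) * w j (S x) = (INR (p + q) - INR x) * w j x;
  law_step_j : forall j x,
    (INR j + 1) ^ 2 * (INR (p + q) - INR j) * w (S j) x =
    (INR p - INR j) * (INR q - INR j) * (INR x - INR j) * w j x;
  law_total : Ex (p + q) w (fun _ _ => 1) = 1 }.

(** Shift x by one and apply [law_step_x]. The end terms vanish: x = 0 forces j = 0 on the support,
    and the factor on the right is 0 at x = p + q. *)
Lemma law_shift_x p q w g : path_law p q w ->
  Ex (p + q) w (fun j x => (x - j) * g j (x - 1)) =
  Ex (p + q) w (fun j x => (INR (p + q) - x) * g j x).
Proof.
intros H. unfold Ex. apply sum_shift.
- apply sum_eq_R0; intros j _.
  destruct (Req_dec (w j 0%nat) 0) as [E|E]; [rewrite E; ring|].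
  apply (law_support _ _ _ H) in E. assert (j = 0%nat) by lia. subst j. simpl; ring.
- apply sum_eq_R0; intros j _. ring.
- intros x. apply sum_eq; intros j _. rewrite S_INR.
  replace (INR x + 1 - 1) with (INR x) by ring.
  transitivity ((INR x + 1 - INR j) * w j (S x) * g (INR j) (INR x)); [ring|].
  rewrite (law_step_x _ _ _ H); ring.
Qed.

(** Shift j by one and apply [law_step_j]. The factor j^2 kills j = 0, and j = p + q lies in the
    support only if it equals [p], where [INR p - j] is 0. *)
Lemma law_shift_j p q w g : path_law p q w ->
  Ex (p + q) w (fun j x => j ^ 2 * (INR (p + q) - j + 1) * g j x) =
  Ex (p + q) w (fun j x => (INR p - j) * (INR q - j) * (x - j) * g (j + 1) x).
Proof.
intros H. unfold Ex. apply sum_eq; intros x _. apply sum_shift.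
- simpl; ring.
- destruct (Req_dec (w (p + q)%nat x) 0) as [E|E]; [rewrite E; ring|].
  apply (law_support _ _ _ H) in E. replace (p + q)%nat with p by lia. ring.
- intros j. rewrite S_INR.
  transitivity ((INR j + 1) ^ 2 * (INR (p + q) - INR j) * w (S j) x * g (INR j + 1) (INR x)); [ring|].
  rewrite (law_step_j _ _ _ H); ring.
Qed.

Lemma Ex_const p q w c : path_law p q w -> Ex (p + q) w (fun _ _ => c) = c.
Proof.
intros H. transitivity (c * Ex (p + q) w (fun _ _ => 1) + Ex (p + q) w (fun _ _ => 0)).
- rewrite <- Ex_lin. apply Ex_ext; intros; ring.
- replace (Ex (p + q) w (fun _ _ => 0)) with 0; [rewrite (law_total _ _ _ H); ring|].
  unfold Ex. symmetry. apply sum_eq_R0; intros x _. apply sum_eq_R0; intros; ring.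
Qed.

(* [h] is a combination of exact identities, so it may be added for free. *)
Lemma Ex_bound p q w f h k c : path_law p q w -> Ex (p + q) w h = 0 ->
  (forall j x, (0 <= j) -> j <= INR p -> j <= INR q -> j <= x -> x <= INR p + INR q ->
     f j x <= c + k * h j x) ->
  Ex (p + q) w f <= c.
Proof.
intros H h0 fle.
rewrite <- (Ex_const p q w c H). rewrite <- (Rplus_0_l (Ex _ _ (fun _ _ => c))).
rewrite <- (Rmult_0_r k), <- h0, <- Ex_lin.
apply Ex_le; [apply (law_ge0 _ _ _ H)|].
intros j x E. apply (law_support _ _ _ H) in E. destruct E as (E1 & E2 & E3 & E4).
rewrite Rplus_comm. apply fle; rewrite <- ?plus_INR; auto using le_INR, pos_INR.
Qed.

(** * Second moments of J and X, and the one-sided Stein bound *)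

Section Moments.
Context (p q : nat) (w : nat -> nat -> R) (Hw : path_law p q w).
(** The point [(j0, mu)] balances both shift identities to leading order: x - j = N - x gives x = (N
    + j)/2, and then j^2 (N - j) = (p - j)(q - j)(x - j) reduces to j^2 + N j = p q. *)
Context (N j0 mu : R) (HN : N = INR p + INR q) (N0 : 0 < N) (j0ge0 : 0 <= j0)
  (Hj0 : j0 * j0 + N * j0 = INR p * INR q) (Hmu : mu = (N + j0) / 2).

Lemma INR_sum_eq : INR (p + q) = N.
Proof. rewrite plus_INR; auto. Qed.

(** N j0 <= p q <= N^2 / 4. *)
Lemma j0_le : j0 <= N / 4.
Proof.
assert (INR p * INR q <= N * N / 4) by (subst N; pose proof (pow2_ge_0 (INR p - INR q)); lra).
apply Rnot_lt_le; intros C. nra.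
Qed.

Lemma Ex_sub f g h : Ex (p + q) w f = Ex (p + q) w g ->
  (forall j x, h j x = f j x - g j x) -> Ex (p + q) w h = 0.
Proof.
intros E Hh. rewrite (Ex_ext _ _ h (fun j x => (-1) * g j x + f j x)) by (intros; rewrite Hh; ring).
rewrite Ex_lin, E; ring.
Qed.

(** Testing [law_shift_x] on x - (N + j)/2 gives 2 E(X - (N+J)/2)^2 = E(X - J), and X - J is at most
    N. *)
Lemma Ex_sq_X_centered_by_J : Ex (p + q) w (fun j x => (x - (N + j) / 2) ^ 2) <= N / 2.
Proof.
apply (Ex_bound p q w _ (fun j x => 2 * (x - (N + j) / 2) ^ 2 - (x - j)) (/ 2)); auto.
- eapply Ex_sub; [apply (law_shift_x p q w (fun j x => x - (N + j) / 2) Hw)|].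
  intros j x; rewrite INR_sum_eq; simpl; field.
- intros; lra.
Qed.

Lemma Ex_sq_J : Ex (p + q) w (fun j x => (j - j0) ^ 2) <= 2 * N.
Proof.
pose (h1 := fun j x : R => j ^ 2 * (N - j + 1) * (j - j0)
   - (INR p - j) * (INR q - j) * (x - j) * (j + 1 - j0)).
pose (h2 := fun j x : R => ((x - j) - (N - x)) * ((INR p - j) * (INR q - j) * (j + 1 - j0))).
(* In [2 * h1 + h2] the variable x cancels. The factor [2 / N ^ 2] is the inverse of the lower bound
   [B1] on the coefficient of (j - j0)^2 that remains. *)
apply (Ex_bound p q w _ (fun j x => 2 * h1 j x + h2 j x) (2 / N ^ 2)); auto.
- rewrite Ex_lin.
  rewrite (Ex_sub _ _ h1 (law_shift_j p q w (fun j x => j - j0) Hw)).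
  2: { intros; rewrite INR_sum_eq; unfold h1; ring. }
  rewrite (Ex_sub _ _ h2 (law_shift_x p q w (fun j x => (INR p - j) * (INR q - j) * (j + 1 - j0)) Hw)).
  2: { intros; rewrite INR_sum_eq; unfold h2; ring. }
  ring.
- intros j x jge jp jq jx xN. pose proof j0_le as jle.
  (* The equation for [j0] makes 2 j^2 - (p - j)(q - j) equal to (j - j0)(j + j0 + N), which
     produces the square; the other two terms are O(N^3). *)
  replace (2 * h1 j x + h2 j x) with
    ((N - j) * (j + j0 + N) * (j - j0) ^ 2 + 2 * j ^ 2 * (j - j0)
     - (INR p - j) * (INR q - j) * (N - j)).
  2: { unfold h1, h2. transitivity (2 * j ^ 2 * (N - j + 1) * (j - j0) - (INR p - j) * (INR q - j) * (N - j) * (j + 1 - j0)); [|ring].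
       replace ((INR p - j) * (INR q - j)) with (j0 * j0 + N * j0 - N * j + j * j) by (rewrite Hj0, HN; ring). ring. }
  apply Rmult_le_reg_r with (N ^ 2 / 2); [nra|].
  replace ((2 * N + 2 / N ^ 2 * ((N - j) * (j + j0 + N) * (j - j0) ^ 2 + 2 * j ^ 2 * (j - j0) - (INR p - j) * (INR q - j) * (N - j))) * (N ^ 2 / 2))
    with (N * N * N + ((N - j) * (j + j0 + N) * (j - j0) ^ 2 + 2 * j ^ 2 * (j - j0) - (INR p - j) * (INR q - j) * (N - j))) by (field; lra).
  assert (jN : j <= N / 2) by lra.
  assert (B1 : N ^ 2 / 2 <= (N - j) * (j + j0 + N)) by nra.
  assert (B2 : 0 <= (j - j0) ^ 2) by apply pow2_ge_0.
  assert (B3 : (j - j0) ^ 2 * (N ^ 2 / 2) <= (N - j) * (j + j0 + N) * (j - j0) ^ 2) by nra.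
  assert (B4 : j ^ 2 <= N * N / 4) by nra.
  assert (B5 : - (N * N * N / 8) <= 2 * j ^ 2 * (j - j0)).
  { assert (0 <= j ^ 2) by apply pow2_ge_0.
    assert (j ^ 2 * (j0 - j) <= j ^ 2 * (N / 4)) by (apply Rmult_le_compat_l; lra).
    assert (j ^ 2 * (N / 4) <= N * N / 4 * (N / 4)) by (apply Rmult_le_compat_r; lra). lra. }
  assert (B6 : (INR p - j) * (INR q - j) <= N * N / 4).
  { assert (INR p * INR q <= N * N / 4) by (rewrite HN; pose proof (pow2_ge_0 (INR p - INR q)); lra). nra. }
  assert (B7 : (INR p - j) * (INR q - j) * (N - j) <= N * N / 4 * N).
  { apply Rmult_le_compat; try lra. apply Rmult_le_pos; lra. }
  nra.
Qed.

(** Split x - mu as (x - (N + j)/2) + (j - j0)/2 and use (a + b)^2 <= 2 a^2 + 2 b^2. *)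
Lemma Ex_sq_X : Ex (p + q) w (fun j x => (x - mu) ^ 2) <= 2 * N.
Proof.
apply Rle_trans with (2 * Ex (p + q) w (fun j x => (x - (N + j) / 2) ^ 2)
   + (/ 2 * Ex (p + q) w (fun j x => (j - j0) ^ 2) + Ex (p + q) w (fun _ _ => 0))).
- rewrite <- !Ex_lin. apply Ex_le; [apply (law_ge0 _ _ _ Hw)|]. intros j x _.
  rewrite Hmu. pose proof (pow2_ge_0 ((INR x - (N + INR j) / 2) - (INR j - j0) / 2)). lra.
- rewrite (Ex_const p q w 0 Hw). pose proof Ex_sq_X_centered_by_J; pose proof Ex_sq_J. lra.
Qed.

(** Since N + 2 j0 is the square root of p^2 + 6 p q + q^2, this is the variance [sigma2_pq] in
    terms of [j0]. *)
Context (s : R) (s0 : 0 < s) (Hs : s ^ 2 = N * (N + j0) / (4 * (N + 2 * j0))).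

Lemma s2_ge : N / 8 <= s ^ 2.
Proof.
rewrite Hs. apply Rmult_le_reg_r with (4 * (N + 2 * j0)); [lra|].
replace (N * (N + j0) / (4 * (N + 2 * j0)) * (4 * (N + 2 * j0))) with (N * (N + j0)) by (field; lra).
nra.
Qed.

(** From t <= (1 + t^2)/2 and [s2_ge]: a first-order deviation divided by [s] has bounded mean once
    E y^2 = O(N). *)
Lemma abs_le_sq y : Rabs y / s <= / 2 + 4 * y ^ 2 / N.
Proof.
assert (H : Rabs y / s <= (1 + (Rabs y / s) ^ 2) / 2) by (pose proof (pow2_ge_0 (Rabs y / s - 1)); lra).
assert (E : (Rabs y / s) ^ 2 = y ^ 2 / s ^ 2).
{ unfold Rdiv. rewrite Rpow_mult_distr, pow2_abs, pow_inv. reflexivity. }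
assert (H2 : y ^ 2 / s ^ 2 <= y ^ 2 * (8 / N)).
{ apply Rmult_le_compat_l; [apply pow2_ge_0|].
  replace (8 / N) with (/ (N / 8)) by (field; lra).
  apply Rinv_le_contravar; [lra|apply s2_ge]. }
rewrite E in H. replace (4 * y ^ 2 / N) with (y ^ 2 * (8 / N) / 2) by (field; lra). lra.
Qed.

(* In the proof, [h1 + h2 / A] is [k s (W F(W) - G(W))] up to [err]: with a = j - j0 and
   b = x - mu, [h2] is F(W) times the expansion A a - 2 j0^2 b + r of the second identity
   at (j0, mu), and adding [h2 / A] to [h1] trades a for (2 - k) b. *)
Lemma stein_upper F G M M' L :
  (forall y, Rabs (F y) <= M) -> (forall y, Rabs (G y) <= M') ->
  (forall y z, Rabs (F y - F z - (y - z) * G y) <= L * (y - z) ^ 2) ->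
  Ex (p + q) w (fun j x => G ((x - mu) / s) - (x - mu) / s * F ((x - mu) / s))
   <= (14 * M + 17 * M' + 8 * L) / s.
Proof.
intros HF HG HL.
set (A := N * (N + j0) / 2). set (k := 2 - 4 * j0 ^ 2 / (N * (N + j0))).
pose proof j0_le as jle.
assert (A0 : N * N / 2 <= A) by (unfold A; nra).
assert (M0 : 0 <= M) by (eapply Rle_trans; [apply Rabs_pos|apply (HF 0)]).
assert (M0' : 0 <= M') by (eapply Rle_trans; [apply Rabs_pos|apply (HG 0)]).
assert (L0 : 0 <= L).
{ specialize (HL 1 0). pose proof (Rabs_pos (F 1 - F 0 - (1 - 0) * G 1)). lra. }
assert (k1 : 1 <= k).
{ unfold k. assert (4 * j0 ^ 2 / (N * (N + j0)) <= 1); [|lra].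
  apply Rmult_le_reg_r with (N * (N + j0)); [nra|].
  replace (4 * j0 ^ 2 / (N * (N + j0)) * (N * (N + j0))) with (4 * j0 ^ 2) by (field; nra). nra. }
(* This equality fixes the variance: it gives W F(W) and G(W) the same coefficient [k * s]. *)
assert (ks : mu - j0 = k * s ^ 2).
{ rewrite Hs, Hmu; unfold k. field_simplify_eq; [ring|]. split; lra. }
pose (h1 := fun j x : R => (x - j) * F ((x - 1 - mu) / s) - (N - x) * F ((x - mu) / s)).
pose (h2 := fun j x : R => j ^ 2 * (N - j + 1) * F ((x - mu) / s)
   - (INR p - j) * (INR q - j) * (x - j) * F ((x - mu) / s)).
assert (h10 : Ex (p + q) w h1 = 0).
{ eapply Ex_sub; [apply (law_shift_x p q w (fun j x => F ((x - mu) / s)) Hw)|].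
  intros; rewrite INR_sum_eq; reflexivity. }
assert (h20 : Ex (p + q) w h2 = 0).
{ eapply Ex_sub; [apply (law_shift_j p q w (fun j x => F ((x - mu) / s)) Hw)|].
  intros; rewrite INR_sum_eq; reflexivity. }
(* The sum of the bounds [Rr], [R1] and [R2] below. Both second moments are at most 2 N, whence the
   constants 14, 17 and 8. *)
pose (err := fun j x : R => (5 * M + 4 * M') / N * (j - j0) ^ 2
   + ((M + 4 * M') / N * (x - mu) ^ 2 + (2 * M + M' + 8 * L))).
assert (Herr : Ex (p + q) w err <= 14 * M + 17 * M' + 8 * L).
{ unfold err. rewrite !Ex_lin, Ex_const by exact Hw.
  pose proof Ex_sq_J as Ha; pose proof Ex_sq_X as Hb.
  apply Rmult_le_compat_l with (r := (5 * M + 4 * M') / N) in Ha;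
    [|apply Rmult_le_pos; [lra|left; apply Rinv_0_lt_compat; lra]].
  apply Rmult_le_compat_l with (r := (M + 4 * M') / N) in Hb;
    [|apply Rmult_le_pos; [lra|left; apply Rinv_0_lt_compat; lra]].
  replace ((5 * M + 4 * M') / N * (2 * N)) with (10 * M + 8 * M') in Ha by (field; lra).
  replace ((M + 4 * M') / N * (2 * N)) with (2 * M + 8 * M') in Hb by (field; lra). lra. }
assert (main : k * s * Ex (p + q) w (fun j x => G ((x - mu) / s) - (x - mu) / s * F ((x - mu) / s))
    <= Ex (p + q) w err).
{ apply Rle_trans with ((-1) * Ex (p + q) w h1 + ((- / A) * Ex (p + q) w h2 + Ex (p + q) w err)); [|rewrite h10, h20; lra].
  rewrite <- (Rplus_0_r (k * s * _)), <- (Ex_const p q w 0 Hw) at 1.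
  rewrite <- !Ex_lin. apply Ex_le; [apply (law_ge0 _ _ _ Hw)|].
  intros jn xn E. apply (law_support _ _ _ Hw) in E. destruct E as (E1 & E2 & E3 & E4).
  apply le_INR in E1, E2, E3, E4. rewrite INR_sum_eq in E4. pose proof (pos_INR jn) as E0.
  revert E0 E1 E2 E3 E4. generalize (INR jn) (INR xn). intros j x E0 E1 E2 E3 E4.
  clear jn xn Herr h10 h20.
  set (W := (x - mu) / s).
  pose proof (HF W) as HFW. pose proof (HG W) as HGW. pose proof (HL W (W - 1 / s)) as HLW.
  replace (W - (W - 1 / s)) with (1 / s) in HLW by ring.
  unfold h1, h2, err. replace ((x - 1 - mu) / s) with (W - 1 / s) by (unfold W; field; lra).
  fold W. set (f := F W) in *. set (g := G W) in *. set (f' := F (W - 1 / s)) in *.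
  set (r := (N - 2 * j0) * ((j - j0) * (x - mu)) - mu * (j - j0) ^ 2 - (j - j0) ^ 2 * (x - mu) + j ^ 2).
  assert (I2 : j ^ 2 * (N - j + 1) * f - (INR p - j) * (INR q - j) * (x - j) * f =
     f * (A * (j - j0) - 2 * j0 ^ 2 * (x - mu) + r)).
  { transitivity (f * (j ^ 2 * (N - j + 1) - (INR p - j) * (INR q - j) * (x - j))); [ring|]. f_equal.
    replace ((INR p - j) * (INR q - j)) with (j0 * j0 + N * j0 - N * j + j * j) by (rewrite Hj0, HN; ring).
    unfold r, A. rewrite Hmu. field. }
  assert (I3 : x - j = k * s ^ 2 + ((x - mu) - (j - j0))) by (rewrite <- ks; ring).
  assert (AK : 2 * j0 ^ 2 / A = 2 - k) by (unfold A, k; field; split; lra).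
  assert (sW : x - mu = s * W) by (unfold W; field; lra).
  (* Every term of [r] is quadratic in the deviations with coefficient O(N), or at most N^2, while
     [A] is at least N^2 / 2. *)
  assert (Rr : Rabs (f * r / A) <= M * (5 / N * (j - j0) ^ 2 + / N * (x - mu) ^ 2 + 2)).
  { assert (Rb : Rabs r <= (N * N / 2) * (5 / N * (j - j0) ^ 2 + / N * (x - mu) ^ 2 + 2)).
    { replace ((N * N / 2) * (5 / N * (j - j0) ^ 2 + / N * (x - mu) ^ 2 + 2)) with
        (N * (5 / 2 * (j - j0) ^ 2 + / 2 * (x - mu) ^ 2) + N * N) by (field; lra).
      assert (T1 : Rabs ((N - 2 * j0) * ((j - j0) * (x - mu))) <= N * (/ 2 * (j - j0) ^ 2 + / 2 * (x - mu) ^ 2)).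
      { rewrite Rabs_mult. apply Rmult_le_compat; try apply Rabs_pos.
        - rewrite Rabs_pos_eq; lra.
        - apply Rabs_le. pose proof (pow2_ge_0 ((j - j0) - (x - mu))).
          pose proof (pow2_ge_0 ((j - j0) + (x - mu))). lra. }
      apply Rabs_le_between in T1.
      assert (T0 : 0 <= (j - j0) ^ 2) by apply pow2_ge_0.
      assert (T2 : mu * (j - j0) ^ 2 <= N * (j - j0) ^ 2) by (apply Rmult_le_compat_r; lra).
      assert (T2' : 0 <= mu * (j - j0) ^ 2) by (apply Rmult_le_pos; lra).
      assert (T3 : Rabs ((j - j0) ^ 2 * (x - mu)) <= N * (j - j0) ^ 2).
      { rewrite Rabs_mult, (Rabs_pos_eq _ T0), Rmult_comm. apply Rmult_le_compat_r; [lra|].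
        apply Rabs_le; lra. }
      apply Rabs_le_between in T3.
      assert (T4 : 0 <= j ^ 2 <= N * N) by (split; [apply pow2_ge_0|nra]).
      apply Rabs_le. unfold r. lra. }
    unfold Rdiv. rewrite !Rabs_mult, Rmult_assoc. apply Rmult_le_compat; auto using Rabs_pos.
    { apply Rmult_le_pos; apply Rabs_pos. }
    rewrite (Rabs_pos_eq (/ A)) by (left; apply Rinv_0_lt_compat; nra).
    apply Rmult_le_reg_r with A; [nra|]. rewrite Rmult_assoc, Rinv_l, Rmult_1_r by nra.
    eapply Rle_trans; [apply Rb|]. rewrite (Rmult_comm (N * N / 2)). apply Rmult_le_compat_l; [|lra].
    assert (0 <= / N) by (left; apply Rinv_0_lt_compat; lra).
    assert (0 <= / N * (j - j0) ^ 2) by (apply Rmult_le_pos; [lra|apply pow2_ge_0]).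
    assert (0 <= / N * (x - mu) ^ 2) by (apply Rmult_le_pos; [lra|apply pow2_ge_0]).
    unfold Rdiv. lra. }
  (* The Taylor error for a step 1/s, taken x - j <= N times; N / s^2 <= 8. *)
  assert (R1 : Rabs ((x - j) * (f - f' - 1 / s * g)) <= 8 * L).
  { rewrite Rabs_mult. apply Rle_trans with (N * (L * (1 / s) ^ 2)).
    - apply Rmult_le_compat; try apply Rabs_pos; auto. rewrite Rabs_pos_eq; lra.
    - pose proof s2_ge as S2.
      replace (N * (L * (1 / s) ^ 2)) with (L * (N / s ^ 2)) by (field; lra).
      rewrite (Rmult_comm 8). apply Rmult_le_compat_l; [exact L0|].
      apply Rmult_le_reg_r with (s ^ 2); [lra|].
      replace (N / s ^ 2 * s ^ 2) with N by (field; lra). lra. }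
  assert (R2 : Rabs (((x - mu) - (j - j0)) * (1 / s * g)) <= M' * (1 + 4 * (j - j0) ^ 2 / N + 4 * (x - mu) ^ 2 / N)).
  { replace (((x - mu) - (j - j0)) * (1 / s * g)) with (g * (((x - mu) - (j - j0)) / s)) by (field; lra).
    rewrite Rabs_mult. apply Rmult_le_compat; auto using Rabs_pos.
    unfold Rdiv at 1. rewrite Rabs_mult, (Rabs_pos_eq (/ s)) by (left; apply Rinv_0_lt_compat; lra).
    pose proof (abs_le_sq (j - j0)). pose proof (abs_le_sq (x - mu)).
    apply Rle_trans with ((Rabs (x - mu) + Rabs (j - j0)) * / s).
    - apply Rmult_le_compat_r; [left; apply Rinv_0_lt_compat; lra|].
      unfold Rminus at 1. eapply Rle_trans; [apply Rabs_triang|]. rewrite Rabs_Ropp. lra.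
    - unfold Rdiv in *. lra. }
  rewrite I2.
  assert (Key : k * s * (g - W * f) + 0 =
    -1 * ((x - j) * f' - (N - x) * f) + (- / A * (f * (A * (j - j0) - 2 * j0 ^ 2 * (x - mu) + r))
     + (f * r / A - (x - j) * (f - f' - 1 / s * g) - ((x - mu) - (j - j0)) * (1 / s * g)))).
  { replace (- / A * (f * (A * (j - j0) - 2 * j0 ^ 2 * (x - mu) + r))) with
      (- f * (j - j0) + (2 * j0 ^ 2 / A) * f * (x - mu) - f * r / A) by (field; apply Rgt_not_eq; nra).
    rewrite AK.
    transitivity ((x - j) * f - (x - j) * f - k * f * (s * W) + k * s ^ 2 * (1 / s * g)); [field; lra|].
    rewrite <- sW.
    assert (Hx : (N - x) * f = (x - j) * f - 2 * (x - mu) * f + (j - j0) * f) by (rewrite Hmu; field).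
    assert (Hg : (x - j) * (1 / s * g) = k * s ^ 2 * (1 / s * g) + ((x - mu) - (j - j0)) * (1 / s * g)) by (rewrite I3 at 1; ring).
    lra. }
  rewrite Key. do 2 apply Rplus_le_compat_l.
  apply Rabs_le_between in Rr, R1, R2. unfold Rdiv in *. lra. }
apply Rmult_le_reg_r with (k * s); [nra|].
rewrite Rmult_comm. eapply Rle_trans; [apply main|]. eapply Rle_trans; [apply Herr|].
replace ((14 * M + 17 * M' + 8 * L) / s * (k * s)) with ((14 * M + 17 * M' + 8 * L) * k) by (field; lra).
nra.
Qed.
End Moments.

(** * The Gaussian distribution function *)

Lemma exp_monotone x y : x <= y -> exp x <= exp y.
Proof. intros [H| ->]; [left; now apply exp_increasing|apply Rle_refl]. Qed.

Lemma gauss_pos y : 0 < gauss y.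
Proof. apply exp_pos. Qed.

Lemma gauss_le1 y : gauss y <= 1.
Proof.
unfold gauss. rewrite <- exp_0. apply exp_monotone.
pose proof (pow2_ge_0 y). lra.
Qed.

Lemma gauss_cont y : continuous gauss y.
Proof. apply continuity_pt_filterlim, gauss_continuous. Qed.

Lemma gauss_ex_RInt a b : ex_RInt gauss a b.
Proof. apply (ex_RInt_continuous (V := R_CompleteNormedModule)); intros; apply gauss_cont. Qed.

Lemma gauss_is_derive (x : R) : is_derive (RInt gauss 0) x (gauss x).
Proof.
apply (is_derive_RInt gauss (RInt gauss 0) 0).
- apply filter_forall; intros y. apply (RInt_correct (V := R_CompleteNormedModule)), gauss_ex_RInt.
- apply gauss_cont.
Qed.

Definition gauss_sq_kernel (x t : R) : R := exp (- (x ^ 2) * (1 + t ^ 2) / 2) / (1 + t ^ 2).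

Lemma one_sq_pos t : 0 < 1 + t ^ 2.
Proof. pose proof (pow2_ge_0 t); lra. Qed.

Lemma gauss_sq_kernel_is_derive (x t : R) :
  is_derive (fun u => gauss_sq_kernel u t) x (- x * exp (- (x ^ 2) * (1 + t ^ 2) / 2)).
Proof.
pose proof (one_sq_pos t). unfold gauss_sq_kernel. auto_derive; [lra|].
simpl in *. unfold Rdiv. set (e := exp _). field. lra.
Qed.

Lemma gauss_sq_kernel_ex_RInt x : ex_RInt (gauss_sq_kernel x) 0 1.
Proof.
apply (ex_RInt_continuous (V := R_CompleteNormedModule)); intros t _. apply (ex_derive_continuous (gauss_sq_kernel x)).
pose proof (one_sq_pos t). unfold gauss_sq_kernel. auto_derive. simpl in H; lra.
Qed.

(** After differentiation under the integral the exponential factors as [gauss x] times the Gaussian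
    at x t, and the substitution y = x t leaves the integral of [gauss] up to x. *)
Lemma gauss_sq_kernel_RInt_is_derive (x : R) :
  is_derive (fun u => RInt (gauss_sq_kernel u) 0 1) x (- gauss x * RInt gauss 0 x).
Proof.
replace (- gauss x * RInt gauss 0 x) with (RInt (fun t => Derive (fun u => gauss_sq_kernel u t) x) 0 1).
- apply is_derive_RInt_param.
  + apply filter_forall; intros y t _. eexists; apply gauss_sq_kernel_is_derive.
  + intros t _.
    apply continuity_2d_pt_ext with (fun u v => (- u) * exp ((- / 2) * ((u * u) * (1 + v * v)))).
    { intros u v. symmetry. etransitivity; [apply is_derive_unique, gauss_sq_kernel_is_derive|].
      f_equal. f_equal. field. }
    assert (c1 : continuity_2d_pt (fun u _ => u) x t) by apply continuity_2d_pt_id1.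
    assert (c2 : continuity_2d_pt (fun _ v => v) x t) by apply continuity_2d_pt_id2.
    apply continuity_2d_pt_mult; [now apply continuity_2d_pt_opp|].
    apply continuity_1d_2d_pt_comp; [apply derivable_continuous_pt, derivable_pt_exp|].
    repeat first [apply continuity_2d_pt_mult | apply continuity_2d_pt_plus
      | apply continuity_2d_pt_const | assumption].
  + apply filter_forall; intros y. apply gauss_sq_kernel_ex_RInt.
- transitivity (RInt (fun t => scal (- gauss x) (scal x (gauss (x * t + 0)))) 0 1).
  + apply RInt_ext; intros t _. etransitivity; [apply is_derive_unique, gauss_sq_kernel_is_derive|].
    unfold scal; simpl; unfold mult; simpl. unfold gauss.
    transitivity (- x * exp (- x ^ 2 / 2 + - (x * t + 0) ^ 2 / 2)).
    { f_equal. f_equal. field. }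
    rewrite exp_plus; ring.
  + etransitivity; [apply (RInt_scal (V := R_CompleteNormedModule))|].
    * apply (ex_RInt_comp_lin gauss), gauss_ex_RInt.
    * etransitivity; [apply f_equal, (RInt_comp_lin gauss), gauss_ex_RInt|].
      unfold scal; simpl; unfold mult; simpl. f_equal. f_equal; ring.
Qed.

(* Both sides have the same derivative in [x] and agree at [x = 0], where the kernel is
   the derivative of [atan]; the kernel is at most [gauss x], so this is the Gaussian integral. *)
Lemma gauss_integral_sq x : 0 <= x ->
  RInt gauss 0 x ^ 2 / 2 + RInt (gauss_sq_kernel x) 0 1 = PI / 4.
Proof.
intros x0.
assert (E0 : RInt gauss 0 0 ^ 2 / 2 + RInt (gauss_sq_kernel 0) 0 1 = PI / 4).
{ rewrite RInt_point. unfold zero; simpl.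
  rewrite (RInt_ext _ (Derive atan)).
  - rewrite RInt_Derive, atan_1, atan_0; [field| |].
    + intros t _. eexists; apply is_derive_atan.
    + intros t _. apply continuous_ext with (fun t => / (1 + t ^ 2)).
      { intros y. symmetry. etransitivity; [apply is_derive_unique, is_derive_atan|].
        unfold Rsqr. f_equal; ring. }
      apply (ex_derive_continuous (fun t => / (1 + t ^ 2))). auto_derive.
      pose proof (one_sq_pos t). simpl in H; lra.
  - intros t _. symmetry. etransitivity; [apply is_derive_unique, is_derive_atan|].
    unfold gauss_sq_kernel. replace (- 0 ^ 2 * (1 + t ^ 2) / 2) with 0 by field.
    rewrite exp_0. unfold Rsqr, Rdiv. rewrite Rmult_1_l. f_equal; ring. }
destruct x0 as [x0| <-]; [|exact E0].
rewrite <- E0. symmetry.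
apply (eq_is_derive (fun u => RInt gauss 0 u ^ 2 / 2 + RInt (gauss_sq_kernel u) 0 1)); [|exact x0].
intros t _.
enough (H : is_derive (fun u => RInt gauss 0 u ^ 2 / 2 + RInt (gauss_sq_kernel u) 0 1) t
  (gauss t * RInt gauss 0 t + - gauss t * RInt gauss 0 t)).
{ replace (gauss t * RInt gauss 0 t + - gauss t * RInt gauss 0 t) with 0 in H by ring. exact H. }
apply (is_derive_plus (fun u => RInt gauss 0 u ^ 2 / 2)); [|apply gauss_sq_kernel_RInt_is_derive].
pose proof (gauss_is_derive t) as Hd.
replace (gauss t * RInt gauss 0 t) with (scal (/ 2) (INR 2 * gauss t * RInt gauss 0 t ^ 1)).
2: { unfold scal; simpl; unfold mult; simpl; field. }
apply is_derive_ext with (fun u => scal (/ 2) (RInt gauss 0 u ^ 2)).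
{ intros u. unfold scal; simpl; unfold mult; simpl; field. }
apply is_derive_scal. apply (is_derive_pow (RInt gauss 0) 2 t (gauss t) Hd).
Qed.

Lemma Phi_RInt x : Phi x = / 2 + / sqrt (2 * PI) * RInt gauss 0 x.
Proof. unfold Phi. now rewrite <- RInt_Reals. Qed.

Lemma sqrt_2PI_ge1 : 1 <= sqrt (2 * PI).
Proof.
rewrite <- sqrt_1. apply sqrt_le_1_alt. pose proof PI2_1. lra.
Qed.

Lemma Phi_diff a b : Phi b - Phi a = / sqrt (2 * PI) * RInt gauss a b.
Proof.
rewrite !Phi_RInt, <- (RInt_Chasles gauss 0 a b) by apply gauss_ex_RInt.
unfold plus; simpl; ring.
Qed.

Lemma Phi_incr a b : a <= b -> 0 <= Phi b - Phi a <= b - a.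
Proof.
intros ab. rewrite Phi_diff. pose proof sqrt_2PI_ge1 as S1.
assert (I0 : 0 <= RInt gauss a b).
{ apply RInt_ge_0; auto using gauss_ex_RInt. intros; left; apply gauss_pos. }
assert (I1 : RInt gauss a b <= b - a).
{ replace (b - a) with (RInt (fun _ => 1) a b).
  - apply RInt_le; auto using gauss_ex_RInt, ex_RInt_const. intros; apply gauss_le1.
  - rewrite RInt_const. unfold scal; simpl; unfold mult; simpl; ring. }
assert (S2 : 0 < / sqrt (2 * PI) <= 1).
{ split; [apply Rinv_0_lt_compat; lra|]. rewrite <- Rinv_1. apply Rinv_le_contravar; lra. }
split; [apply Rmult_le_pos; lra|]. nra.
Qed.

Lemma Phi_opp x : Phi (- x) = 1 - Phi x.
Proof.
rewrite !Phi_RInt.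
replace (RInt gauss 0 (- x)) with (- RInt gauss 0 x); [field; pose proof sqrt_2PI_ge1; lra|].
replace (RInt gauss 0 (- x)) with (RInt gauss (-1 * 0 + 0) (-1 * x + 0)) by (f_equal; ring).
rewrite <- (RInt_comp_lin gauss) by apply gauss_ex_RInt.
symmetry. rewrite (RInt_ext _ (fun y => scal (-1) (gauss y))).
- etransitivity; [apply (RInt_scal (V := R_CompleteNormedModule)), gauss_ex_RInt|].
  unfold scal; simpl; unfold mult; simpl; ring.
- intros t _. unfold gauss. now replace ((-1 * t + 0) ^ 2) with (t ^ 2) by ring.
Qed.

(** With y = 2 Phi(x) - 1 and h the kernel integral, [gauss_integral_sq] gives y^2 = 1 - 4 h / PI,
    where h <= gauss x <= 2 / x^2; for 0 <= y <= 1 the lower bound passes from y^2 to y. *)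
Lemma Phi_bounds x : 0 < x -> 1 - 2 / x ^ 2 <= Phi x <= 1.
Proof.
intros x0. pose proof (gauss_integral_sq x (Rlt_le _ _ x0)) as E.
assert (K0 : 0 <= RInt (gauss_sq_kernel x) 0 1).
{ apply RInt_ge_0; [lra|apply gauss_sq_kernel_ex_RInt|]. intros t _. unfold gauss_sq_kernel.
  pose proof (one_sq_pos t). apply Rmult_le_pos; left; [apply exp_pos|now apply Rinv_0_lt_compat]. }
assert (K1 : RInt (gauss_sq_kernel x) 0 1 <= gauss x).
{ replace (gauss x) with (RInt (fun _ => gauss x) 0 1).
  2: { rewrite RInt_const. unfold scal; simpl; unfold mult; simpl; ring. }
  apply RInt_le; [lra|apply gauss_sq_kernel_ex_RInt|apply ex_RInt_const|].
  intros t _. unfold gauss_sq_kernel, gauss. pose proof (one_sq_pos t). pose proof (pow2_ge_0 t).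
  pose proof (pow2_ge_0 x).
  apply Rle_trans with (exp (- x ^ 2 * (1 + t ^ 2) / 2) / 1).
  - apply Rmult_le_compat_l; [left; apply exp_pos|]. apply Rinv_le_contravar; lra.
  - unfold Rdiv. rewrite Rinv_1, Rmult_1_r. apply exp_monotone. nra. }
assert (K2 : gauss x <= 2 / x ^ 2).
{ pose proof (pow2_gt_0 x (Rgt_not_eq _ _ x0)) as x2. unfold gauss.
  replace (- x ^ 2 / 2) with (- (x ^ 2 / 2)) by field. rewrite exp_Ropp.
  replace (2 / x ^ 2) with (/ (x ^ 2 / 2)) by (field; lra).
  apply Rinv_le_contravar; [lra|]. pose proof (exp_ineq1_le (x ^ 2 / 2)). lra. }
pose proof sqrt_2PI_ge1 as S1.
assert (S2 : sqrt (2 * PI) * sqrt (2 * PI) = 2 * PI) by (apply sqrt_def; pose proof PI_RGT_0; lra).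
rewrite Phi_RInt. set (r := sqrt (2 * PI)) in *.
assert (I0 : 0 <= RInt gauss 0 x).
{ apply RInt_ge_0; auto using gauss_ex_RInt; [lra|]. intros; left; apply gauss_pos. }
set (g := RInt gauss 0 x) in *. set (h := RInt (gauss_sq_kernel x) 0 1) in *.
pose proof PI2_1.
assert (Ey : (2 * (/ r * g)) ^ 2 = 1 - 4 * h / PI).
{ replace ((2 * (/ r * g)) ^ 2) with (4 * g ^ 2 / (r * r)) by (field; lra).
  rewrite S2. replace (g ^ 2) with (PI / 2 - 2 * h) by lra. field; lra. }
assert (y0 : 0 <= 2 * (/ r * g)).
{ apply Rmult_le_pos; [lra|]. apply Rmult_le_pos; [|exact I0]. left; apply Rinv_0_lt_compat; lra. }
set (y := 2 * (/ r * g)) in *. replace (/ r * g) with (y / 2) by (unfold y; field; lra).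
assert (h1 : 0 <= 4 * h / PI <= 2 * h).
{ split; [apply Rmult_le_pos; [lra|left; apply Rinv_0_lt_compat; lra]|].
  apply Rmult_le_reg_r with PI; [lra|]. unfold Rdiv. rewrite Rmult_assoc, Rinv_l by lra. nra. }
assert (y1 : y <= 1) by nra.
split; [|lra]. nra.
Qed.

Lemma Phi_01 x : 0 <= Phi x <= 1.
Proof.
assert (H : forall y, Phi y <= 1).
{ intros y. pose proof (Phi_incr y (Rabs y + 1)). pose proof (Rabs_pos y).
  pose proof (Rle_abs y). pose proof (Phi_bounds (Rabs y + 1)). lra. }
split; [|apply H]. pose proof (H (- x)) as H'. rewrite Phi_opp in H'. lra.
Qed.

(** * Stein's equation and test functions *)

Lemma MVT_lipschitz f f' D : (forall y, is_derive f y (f' y)) -> (forall y, Rabs (f' y) <= D) ->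
  forall y z, Rabs (f y - f z) <= D * Rabs (y - z).
Proof.
intros Hd Hb y z. destruct (MVT_gen f z y f') as (c & _ & ->).
- intros; apply Hd.
- intros; apply continuity_pt_filterlim, (ex_derive_continuous f). eexists; apply Hd.
- rewrite Rabs_mult. apply Rmult_le_compat_r; auto using Rabs_pos.
Qed.

Lemma lipschitz_continuous psi K : (forall y z, Rabs (psi y - psi z) <= K * Rabs (y - z)) ->
  forall x, continuous psi x.
Proof.
intros HK x. apply filterlim_locally. intros eps.
assert (K0 : 0 <= K).
{ specialize (HK 1 0). pose proof (Rabs_pos (psi 1 - psi 0)).
  replace (Rabs (1 - 0)) with 1 in HK by (rewrite Rabs_pos_eq; lra). lra. }
assert (d0 : 0 < eps / (K + 1)) by (apply Rdiv_lt_0_compat; [apply cond_pos|lra]).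
exists (mkposreal _ d0). intros y Hy. unfold ball in *; simpl in *. unfold AbsRing_ball, abs, minus, plus, opp in *; simpl in *.
eapply Rle_lt_trans; [apply HK|].
apply Rle_lt_trans with ((K + 1) * Rabs (y + - x)).
- apply Rmult_le_compat_r; [apply Rabs_pos|lra].
- apply Rlt_le_trans with ((K + 1) * (eps / (K + 1))); [apply Rmult_lt_compat_l; lra|].
  right; field; lra.
Qed.

(** [F] satisfies F'(y) = y F(y) + psi(y), so the last bound is its first-order Taylor estimate. As
    [F] also vanishes outside [-B, B], continuity on a compact interval suffices for boundedness. *)
Lemma stein_solution B K P psi : 0 < B ->
  (forall y z, Rabs (psi y - psi z) <= K * Rabs (y - z)) ->
  (forall y, Rabs (psi y) <= P) ->
  (forall y, B <= Rabs y -> psi y = 0) ->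
  RInt (fun y => psi y * gauss y) (- B) B = 0 ->
  exists F M M' L,
    (forall y, Rabs (F y) <= M) /\ (forall y, Rabs (y * F y + psi y) <= M') /\
    (forall y z, Rabs (F y - F z - (y - z) * (y * F y + psi y)) <= L * (y - z) ^ 2).
Proof.
intros B0 HK HP Hsupp Hint.
assert (cont : forall y, continuous (fun y => psi y * gauss y) y).
{ intros y. apply (continuous_mult psi gauss); [now apply lipschitz_continuous with K|apply gauss_cont]. }
assert (exI : forall a b, ex_RInt (fun y => psi y * gauss y) a b).
{ intros a b; apply (ex_RInt_continuous (V := R_CompleteNormedModule)); intros; apply cont. }
set (I := RInt (fun y => psi y * gauss y) (- B)).
set (F := fun y => exp (y ^ 2 / 2) * I y).
assert (dI : forall y, is_derive I y (psi y * gauss y)).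
{ intros y. apply (is_derive_RInt (fun y => psi y * gauss y) I (- B)); [|apply cont].
  apply filter_forall; intros z. apply (RInt_correct (V := R_CompleteNormedModule)), exI. }
assert (dF : forall y, is_derive F y (y * F y + psi y)).
{ intros y. unfold F.
  replace (y * (exp (y ^ 2 / 2) * I y) + psi y) with
    (plus (mult (y * exp (y ^ 2 / 2)) (I y)) (mult (exp (y ^ 2 / 2)) (psi y * gauss y))).
  - apply (is_derive_mult (fun y => exp (y ^ 2 / 2)) I); [|apply dI|intros; apply Rmult_comm].
    auto_derive; [auto|]. simpl; unfold Rdiv; set (e := exp _); field.
  - assert (E : exp (y ^ 2 / 2) * gauss y = 1).
    { unfold gauss. rewrite <- exp_plus. replace (y ^ 2 / 2 + - y ^ 2 / 2) with 0 by field. apply exp_0. }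
    change (y * exp (y ^ 2 / 2) * I y + exp (y ^ 2 / 2) * (psi y * gauss y) =
      y * (exp (y ^ 2 / 2) * I y) + psi y).
    replace (exp (y ^ 2 / 2) * (psi y * gauss y)) with (exp (y ^ 2 / 2) * gauss y * psi y) by ring.
    rewrite E; ring. }
(* This is where the vanishing Gaussian mean of [psi] is used. *)
assert (F0 : forall y, B <= Rabs y -> F y = 0).
{ intros y Hy. unfold F. replace (I y) with 0; [ring|]. unfold I.
  assert (Z : forall a b, (forall t, Rmin a b < t < Rmax a b -> B <= Rabs t) ->
     RInt (fun y => psi y * gauss y) a b = 0).
  { intros a b Hab. rewrite (RInt_ext _ (fun _ => 0)).
    - rewrite RInt_const. unfold scal; simpl; unfold mult; simpl; ring.
    - intros t Ht. rewrite Hsupp by auto. apply Rmult_0_l. }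
  symmetry. destruct (Rle_dec 0 y) as [y0|y0].
  - rewrite Rabs_pos_eq in Hy by exact y0.
    rewrite <- (RInt_Chasles _ (- B) B y) by apply exI. rewrite Hint, Z.
    + unfold plus; simpl; ring.
    + intros t. rewrite Rmin_left, Rmax_right by exact Hy. intros Ht.
      rewrite Rabs_pos_eq; lra.
  - rewrite Rabs_left in Hy by lra. apply Z.
    intros t. rewrite Rmin_right, Rmax_left by lra. intros Ht. rewrite Rabs_left; lra. }
destruct (continuity_ab_maj (fun y => Rabs (F y)) (- B) B) as (m & Hm & _); [lra| |].
{ intros c _. apply continuity_pt_filterlim. apply (continuous_comp F Rabs).
  - apply (ex_derive_continuous F). eexists; apply dF.
  - apply continuous_Rabs. }
set (M := Rabs (F m)).
assert (M0 : 0 <= M) by apply Rabs_pos.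
assert (HM : forall y, Rabs (F y) <= M).
{ intros y. destruct (Rle_dec B (Rabs y)) as [h|h].
  - rewrite F0, Rabs_R0 by exact h. exact M0.
  - apply Hm. apply Rabs_le_between. lra. }
assert (weighted : forall f C, 0 <= C -> (forall y, B <= Rabs y -> f y = 0) -> (forall y, Rabs (f y) <= C) ->
   forall y, Rabs (y * f y) <= B * C).
{ intros f C C0 f0 fC y. destruct (Rle_dec B (Rabs y)) as [h|h].
  - rewrite f0, Rmult_0_r, Rabs_R0 by exact h. nra.
  - rewrite Rabs_mult. apply Rmult_le_compat; auto using Rabs_pos. lra. }
assert (P0 : 0 <= P) by (eapply Rle_trans; [apply Rabs_pos|apply (HP 0)]).
set (M' := B * M + P).
assert (HM' : forall y, Rabs (y * F y + psi y) <= M').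
{ intros y. eapply Rle_trans; [apply Rabs_triang|]. apply Rplus_le_compat; auto. }
assert (M'0 : 0 <= M') by (eapply Rle_trans; [apply Rabs_pos|apply (HM' 0)]).
(* A Lipschitz constant of F': the derivative of y F(y) is F + y F', bounded by M + B M', and psi
   contributes K. *)
set (L := M + B * M' + K).
assert (HL : forall y z, Rabs ((y * F y + psi y) - (z * F z + psi z)) <= L * Rabs (y - z)).
{ intros y z.
  replace ((y * F y + psi y) - (z * F z + psi z)) with ((y * F y - z * F z) + (psi y - psi z)) by ring.
  eapply Rle_trans; [apply Rabs_triang|].
  unfold L. rewrite Rmult_plus_distr_r. apply Rplus_le_compat; [|apply HK].
  apply (MVT_lipschitz (fun y => y * F y) (fun y => F y + y * (y * F y + psi y))).
  - intros t. replace (F t + t * (t * F t + psi t)) with (plus (mult one (F t)) (mult t (t * F t + psi t))).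
    + apply (is_derive_mult (fun y => y) F); [exact (is_derive_id (K := R_AbsRing) t)|apply dF|intros; apply Rmult_comm].
    + unfold plus, mult, one; simpl; ring.
  - intros t. eapply Rle_trans; [apply Rabs_triang|]. apply Rplus_le_compat; [apply HM|].
    apply (weighted (fun t => t * F t + psi t)); auto.
    intros s Hs. rewrite F0, Hsupp by exact Hs. ring. }
exists F, M, M', L. split; [exact HM|]. split; [exact HM'|].
intros y z. destruct (MVT_gen F z y (fun y => y * F y + psi y)) as (c & Hc & E).
- intros; apply dF.
- intros; apply continuity_pt_filterlim, (ex_derive_continuous F). eexists; apply dF.
- rewrite E.
  replace ((c * F c + psi c) * (y - z) - (y - z) * (y * F y + psi y)) with
    (((c * F c + psi c) - (y * F y + psi y)) * (y - z)) by ring.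
  rewrite Rabs_mult.
  replace (L * (y - z) ^ 2) with (L * Rabs (y - z) * Rabs (y - z)).
  2: { rewrite <- (pow2_abs (y - z)). ring. }
  apply Rmult_le_compat_r; [apply Rabs_pos|].
  eapply Rle_trans; [apply HL|].
  assert (L0 : 0 <= L).
  { specialize (HL 1 0). rewrite (Rabs_pos_eq (1 - 0)) in HL by lra.
    eapply Rle_trans; [apply Rabs_pos|]. rewrite Rminus_0_r, Rmult_1_r in HL. apply HL. }
  apply Rmult_le_compat_l; [exact L0|].
  unfold Rmin, Rmax in Hc. destruct (Rle_dec z y); apply Rabs_le; split;
   unfold Rabs; destruct Rcase_abs; lra.
Qed.

(** A Lipschitz majorant of the indicator of [a, b], with linear ramps of width [eta] outside the
    interval. *)
Definition trapezoid (a b eta y : R) : R :=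
  Rmax 0 (Rmin 1 (Rmin ((y - a) / eta + 1) ((b - y) / eta + 1))).

Lemma trapezoid_01 a b eta y : 0 <= trapezoid a b eta y <= 1.
Proof.
unfold trapezoid. split; [apply Rmax_l|]. apply Rmax_lub; [lra|apply Rmin_l].
Qed.

Lemma trapezoid_in a b eta y : 0 < eta -> a <= y <= b -> trapezoid a b eta y = 1.
Proof.
intros e0 H. unfold trapezoid.
assert (0 <= (y - a) / eta) by (apply Rmult_le_pos; [lra|left; now apply Rinv_0_lt_compat]).
assert (0 <= (b - y) / eta) by (apply Rmult_le_pos; [lra|left; now apply Rinv_0_lt_compat]).
rewrite (Rmin_left 1), Rmax_right; try lra. apply Rmin_glb; lra.
Qed.

Lemma trapezoid_out a b eta y : 0 < eta -> y <= a - eta \/ b + eta <= y -> trapezoid a b eta y = 0.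
Proof.
intros e0 H. unfold trapezoid. apply Rmax_left.
eapply Rle_trans; [apply Rmin_r|].
destruct H as [H|H]; [eapply Rle_trans; [apply Rmin_l|]|eapply Rle_trans; [apply Rmin_r|]];
 apply Rmult_le_reg_r with eta; auto; rewrite Rmult_plus_distr_r; unfold Rdiv;
 rewrite Rmult_assoc, Rinv_l; lra.
Qed.

Lemma trapezoid_lip a b eta : 0 < eta ->
  forall y z, Rabs (trapezoid a b eta y - trapezoid a b eta z) <= / eta * Rabs (y - z).
Proof.
intros e0 y z.
set (d := / eta * Rabs (y - z)).
assert (lmax : forall u v, Rabs (u - v) <= d -> Rabs (Rmax 0 u - Rmax 0 v) <= d).
{ intros u v H. apply Rabs_le_between in H. apply Rabs_le.
  unfold Rmax; do 2 destruct Rle_dec; lra. }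
assert (lmin : forall u v u' v', Rabs (u - v) <= d -> Rabs (u' - v') <= d ->
   Rabs (Rmin u u' - Rmin v v') <= d).
{ intros u v u' v' H H'. apply Rabs_le_between in H, H'. apply Rabs_le.
  unfold Rmin; do 2 destruct Rle_dec; lra. }
assert (d0 : 0 <= d) by (apply Rmult_le_pos; [left; now apply Rinv_0_lt_compat|apply Rabs_pos]).
apply lmax, lmin; [rewrite Rminus_diag, Rabs_R0; exact d0|apply lmin].
- replace ((y - a) / eta + 1 - ((z - a) / eta + 1)) with (/ eta * (y - z)) by (field; lra).
  rewrite Rabs_mult, Rabs_pos_eq; [apply Rle_refl|left; now apply Rinv_0_lt_compat].
- replace ((b - y) / eta + 1 - ((b - z) / eta + 1)) with (- (/ eta * (y - z))) by (field; lra).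
  rewrite Rabs_Ropp, Rabs_mult, Rabs_pos_eq; [apply Rle_refl|left; now apply Rinv_0_lt_compat].
Qed.

Definition gauss_mass (B : R) (f : R -> R) : R := RInt (fun y => f y * gauss y) (- B) B.

Lemma trapezoid_continuous a b eta y : 0 < eta -> continuous (trapezoid a b eta) y.
Proof. intros H. apply lipschitz_continuous with (/ eta). now apply trapezoid_lip. Qed.

Lemma trapezoid_ex_RInt a b eta c d : 0 < eta ->
  ex_RInt (fun y => trapezoid a b eta y * gauss y) c d.
Proof.
intros H. apply (ex_RInt_continuous (V := R_CompleteNormedModule)); intros y _.
apply (continuous_mult (trapezoid a b eta) gauss); [now apply trapezoid_continuous|apply gauss_cont].
Qed.

Lemma trapezoid_mass B a b eta : 0 < eta -> a <= b -> - B <= a - eta -> b + eta <= B ->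
  Phi b - Phi a <= / sqrt (2 * PI) * gauss_mass B (trapezoid a b eta) <= Phi (b + eta) - Phi (a - eta).
Proof.
intros e0 ab aB bB. rewrite !Phi_diff. pose proof sqrt_2PI_ge1.
assert (S2 : 0 <= / sqrt (2 * PI)) by (left; apply Rinv_0_lt_compat; lra).
assert (exT := fun c d => trapezoid_ex_RInt a b eta c d e0).
assert (ge : forall y, 0 <= trapezoid a b eta y * gauss y).
{ intros y. pose proof (trapezoid_01 a b eta y); pose proof (gauss_pos y). apply Rmult_le_pos; lra. }
assert (split3 : forall c d, gauss_mass B (trapezoid a b eta) =
  RInt (fun y => trapezoid a b eta y * gauss y) (- B) c
  + RInt (fun y => trapezoid a b eta y * gauss y) c d
  + RInt (fun y => trapezoid a b eta y * gauss y) d B).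
{ intros c d. unfold gauss_mass.
  rewrite <- (RInt_Chasles _ (- B) d B), <- (RInt_Chasles _ (- B) c d) by apply exT. reflexivity. }
split; apply Rmult_le_compat_l; auto.
- rewrite (split3 a b).
  assert (0 <= RInt (fun y => trapezoid a b eta y * gauss y) (- B) a)
    by (apply RInt_ge_0; auto; lra).
  assert (0 <= RInt (fun y => trapezoid a b eta y * gauss y) b B)
    by (apply RInt_ge_0; auto; lra).
  replace (RInt gauss a b) with (RInt (fun y => trapezoid a b eta y * gauss y) a b); [lra|].
  apply RInt_ext. intros y. rewrite Rmin_left, Rmax_right by exact ab. intros Hy.
  rewrite trapezoid_in by lra. apply Rmult_1_l.
- rewrite (split3 (a - eta) (b + eta)).
  assert (Z : forall c d, c <= d -> (forall y, c < y < d -> y <= a - eta \/ b + eta <= y) ->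
    RInt (fun y => trapezoid a b eta y * gauss y) c d = 0).
  { intros c d cd Hcd. rewrite (RInt_ext _ (fun _ => 0)).
    - rewrite RInt_const. unfold scal; simpl; unfold mult; simpl; ring.
    - intros y. rewrite Rmin_left, Rmax_right by exact cd. intros Hy.
      rewrite trapezoid_out by auto. apply Rmult_0_l. }
  rewrite (Z (- B) (a - eta)), (Z (b + eta) B); try lra; try (intros; lra).
  rewrite Rplus_0_l, Rplus_0_r.
  apply RInt_le; auto using gauss_ex_RInt; [lra|].
  intros y _. pose proof (trapezoid_01 a b eta y); pose proof (gauss_pos y). nra.
Qed.

(** * The length of a random jump path *)

Definition joint_law (p q j k : nat) : R := INR (Counting.weight p q j k) / total_paths p q.

Lemma total_paths_pos p q : 0 < total_paths p q.
Proof.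
unfold total_paths.
assert (H : forall n, 1 <= sum_f_R0 (fun j => INR (u p q j)) n).
{ induction n as [|n IH]; simpl sum_f_R0.
  - rewrite Counting.u_paths, Counting.paths_at0. apply Rle_refl.
  - pose proof (pos_INR (u p q (S n))); lra. }
apply Rlt_le_trans with 1; [lra|apply H].
Qed.

Lemma prob_X_joint p q k : prob_X p q k = sum_f_R0 (fun j => joint_law p q j k) (p + q).
Proof.
unfold prob_X, joint_law, Rdiv. rewrite Counting.u_sum_weight, Rmult_comm, scal_sum. reflexivity.
Qed.

Lemma joint_law_path_law p q : path_law p q (joint_law p q).
Proof.
pose proof (total_paths_pos p q) as T0.
split; unfold joint_law.
- intros j x. apply Rmult_le_pos; [apply pos_INR|left; now apply Rinv_0_lt_compat].
- intros j x H.
  destruct (Counting.weight_support_le p q j x); auto.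
  intros E; apply H. rewrite E. apply Rmult_0_l.
- intros j x. pose proof (Counting.weight_step_k_INR p q j x) as E. unfold Rdiv.
  rewrite <- !Rmult_assoc. now rewrite E.
- intros j x. pose proof (Counting.weight_step_j_INR p q j x) as E. unfold Rdiv.
  rewrite <- !Rmult_assoc. now rewrite E.
- unfold Ex. apply Rmult_eq_reg_r with (total_paths p q); [|lra].
  rewrite Rmult_1_l, Rmult_comm, scal_sum.
  transitivity (sum_f_R0 (fun k => INR (u p q k)) (p + q)); [|reflexivity].
  apply sum_eq; intros k _.
  rewrite Rmult_comm, scal_sum, Counting.u_sum_weight. apply sum_eq; intros j _. field; lra.
Qed.

Lemma cdf_Ex p q m s t : cdf_normalized p q m s t =
  Ex (p + q) (joint_law p q) (fun _ x => if Rle_dec ((x - m) / s) t then 1 else 0).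
Proof.
unfold cdf_normalized, Ex. change (ssrnat.addn p q) with (p + q)%nat. apply sum_eq; intros k _. rewrite prob_X_joint.
destruct Rle_dec.
- apply sum_eq; intros; ring.
- symmetry. apply sum_eq_R0; intros; ring.
Qed.

(** The nonnegative root of j^2 + N j = p q, whose discriminant N^2 + 4 p q is p^2 + 6 p q + q^2. *)
Definition root_j0 (p q : nat) : R :=
  (sqrt (INR p ^ 2 + 6 * INR p * INR q + INR q ^ 2) - (INR p + INR q)) / 2.

Definition Ex_W (p q : nat) (h : R -> R) : R :=
  Ex (p + q) (joint_law p q) (fun _ x =>
    h ((x - mu_pq (INR p) (INR q)) / sqrt (sigma2_pq (INR p) (INR q)))).

Lemma discriminant_facts p q : (0 < p + q)%nat ->
  let N := INR p + INR q in let j0 := root_j0 p q in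
  0 < N /\ 0 <= j0 /\ j0 * j0 + N * j0 = INR p * INR q /\
  mu_pq (INR p) (INR q) = (N + j0) / 2 /\
  0 < sqrt (sigma2_pq (INR p) (INR q)) /\
  sqrt (sigma2_pq (INR p) (INR q)) ^ 2 = N * (N + j0) / (4 * (N + 2 * j0)).
Proof.
intros H N j0.
assert (N0 : 0 < N) by (unfold N; rewrite <- plus_INR; apply lt_0_INR; exact H).
unfold j0, root_j0, mu_pq, sigma2_pq. fold N.
pose proof (pos_INR p) as p0; pose proof (pos_INR q) as q0.
set (P := INR p) in *. set (Q := INR q) in *.
assert (D0 : 0 <= P ^ 2 + 6 * P * Q + Q ^ 2) by nra.
set (D := sqrt (P ^ 2 + 6 * P * Q + Q ^ 2)).
assert (DD : D * D = N * N + 4 * (P * Q)) by (unfold D; rewrite sqrt_def by exact D0; unfold N; ring).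
assert (Dge : 0 <= D) by apply sqrt_pos.
assert (DN : N <= D) by (apply Rnot_lt_le; intros C; nra).
assert (s2 : 0 < N / 8 + N ^ 2 / (8 * D)).
{ apply Rplus_lt_le_0_compat; [lra|]. apply Rmult_le_pos; [nra|]. left; apply Rinv_0_lt_compat; lra. }
repeat split; try lra.
- now apply sqrt_lt_R0.
- rewrite pow2_sqrt by lra. field. lra.
Qed.

(** The constant is 2 N from [Ex_sq_X] divided by N / 8 from [s2_ge]. *)
Lemma Ex_W_sq p q : (0 < p + q)%nat -> Ex_W p q (fun y => y ^ 2) <= 16.
Proof.
intros H. destruct (discriminant_facts p q H) as (N0 & j00 & Hj0 & Hmu & s0 & Hs).
pose proof (joint_law_path_law p q) as Hw. unfold Ex_W.
pose proof (Ex_sq_X p q _ Hw _ _ _ eq_refl N0 j00 Hj0 Hmu) as Hb.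
pose proof (s2_ge _ _ N0 j00 _ Hs) as S2.
set (s := sqrt _) in *. set (mu := mu_pq _ _) in *. set (N := INR p + INR q) in *.
apply Rle_trans with (8 / N * Ex (p + q) (joint_law p q) (fun _ x => (x - mu) ^ 2)
   + Ex (p + q) (joint_law p q) (fun _ _ => 0)).
- rewrite <- Ex_lin. apply Ex_le; [apply (law_ge0 _ _ _ Hw)|]. intros _ x _.
  replace (((INR x - mu) / s) ^ 2) with (/ s ^ 2 * (INR x - mu) ^ 2) by (field; lra).
  rewrite Rplus_0_r. apply Rmult_le_compat_r; [apply pow2_ge_0|].
  replace (8 / N) with (/ (N / 8)) by (field; lra). apply Rinv_le_contravar; lra.
- rewrite (Ex_const p q _ 0 Hw), Rplus_0_r.
  apply Rmult_le_reg_r with (N / 8); [lra|].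
  replace (8 / N * Ex (p + q) (joint_law p q) (fun _ x => (x - mu) ^ 2) * (N / 8)) with
    (Ex (p + q) (joint_law p q) (fun _ x => (x - mu) ^ 2)) by (field; lra). lra.
Qed.

Lemma Ex_W_stein F M M' L psi :
  (forall y, Rabs (F y) <= M) -> (forall y, Rabs (y * F y + psi y) <= M') ->
  (forall y z, Rabs (F y - F z - (y - z) * (y * F y + psi y)) <= L * (y - z) ^ 2) ->
  forall p q, (0 < p + q)%nat ->
  Ex_W p q psi <= (14 * M + 17 * M' + 8 * L) / sqrt (sigma2_pq (INR p) (INR q)).
Proof.
intros HF HG HL p q H. destruct (discriminant_facts p q H) as (N0 & j00 & Hj0 & Hmu & s0 & Hs).
pose proof (joint_law_path_law p q) as Hw.
eapply Rle_trans; [|apply (stein_upper p q _ Hw _ _ _ eq_refl N0 j00 Hj0 Hmu _ s0 Hs F _ M M' L HF HG HL)].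
right. apply Ex_ext. intros _ x. ring.
Qed.

(** Subtracting a multiple of the wide trapezoid over [-A, A] centres the test function while
    keeping compact support. The wide one has expectation at most 1 under the path law, and Gaussian
    mass at least 2 Phi(A) - 1 >= 1 - 4 / A^2. *)
Lemma trapezoid_bound A a b eta : 2 < A -> - A <= a -> a <= b -> b <= A -> 0 < eta ->
  exists K, 0 <= K /\ forall p q, (0 < p + q)%nat ->
  Ex_W p q (trapezoid a b eta) <=
    (Phi (b + eta) - Phi (a - eta)) / (1 - 4 / A ^ 2) + K / sqrt (sigma2_pq (INR p) (INR q)).
Proof.
intros A2 Aa ab bA e0.
assert (A4 : 4 / A ^ 2 < 1).
{ apply Rmult_lt_reg_r with (A ^ 2); [nra|]. unfold Rdiv. rewrite Rmult_assoc, Rinv_l; nra. }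
set (B := A + eta).
destruct (trapezoid_mass B a b eta) as [m1 m2]; try (unfold B; lra).
destruct (trapezoid_mass B (- A) A eta) as [m3 _]; try (unfold B; lra).
rewrite Phi_opp in m3. destruct (Phi_bounds A) as [m4 _]; [lra|].
pose proof sqrt_2PI_ge1 as S1.
set (I := gauss_mass B (trapezoid a b eta)) in *.
set (I0 := gauss_mass B (trapezoid (- A) A eta)) in *.
set (r := / sqrt (2 * PI)) in *.
assert (r0 : 0 < r) by (apply Rinv_0_lt_compat; lra).
assert (d0 : 1 - 4 / A ^ 2 <= r * I0) by lra.
assert (I00 : 0 < I0) by nra.
pose proof (Phi_incr a b ab) as Pab.
assert (Ige : 0 <= I) by nra.
(* The multiple that makes the Gaussian mean of [psi] zero. *)
set (lam := I / I0).
assert (lam0 : 0 <= lam) by (apply Rmult_le_pos; [|left; apply Rinv_0_lt_compat]; lra).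
assert (lamle : lam <= (Phi (b + eta) - Phi (a - eta)) / (1 - 4 / A ^ 2)).
{ replace lam with ((r * I) / (r * I0)) by (unfold lam; field; split; lra).
  apply Rle_trans with ((r * I) / (1 - 4 / A ^ 2)).
  - apply Rmult_le_compat_l; [apply Rmult_le_pos; lra|]. apply Rinv_le_contravar; lra.
  - apply Rmult_le_compat_r; [left; apply Rinv_0_lt_compat|]; lra. }
pose (psi := fun y => trapezoid a b eta y + - lam * trapezoid (- A) A eta y).
destruct (stein_solution B (/ eta + lam * / eta) (1 + lam) psi) as (F & M & M' & L & HM & HM' & HL).
- unfold B; lra.
- intros y z. unfold psi.
  replace (_ - _) with ((trapezoid a b eta y - trapezoid a b eta z)
    + - (lam * (trapezoid (- A) A eta y - trapezoid (- A) A eta z))) by ring.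
  eapply Rle_trans; [apply Rabs_triang|]. rewrite Rabs_Ropp, Rabs_mult, (Rabs_pos_eq lam) by exact lam0.
  rewrite Rmult_plus_distr_r, Rmult_assoc. apply Rplus_le_compat; [now apply trapezoid_lip|].
  apply Rmult_le_compat_l; [exact lam0|now apply trapezoid_lip].
- intros y. unfold psi. pose proof (trapezoid_01 a b eta y). pose proof (trapezoid_01 (- A) A eta y).
  apply Rabs_le. nra.
- intros y Hy. unfold psi.
  assert (Hy' : y <= - B \/ B <= y) by (revert Hy; unfold Rabs; destruct Rcase_abs; lra).
  unfold B in Hy'. rewrite !trapezoid_out; try exact e0; [ring|lra|lra].
- rewrite (RInt_ext _ (fun y => plus (trapezoid a b eta y * gauss y)
     (scal (- lam) (trapezoid (- A) A eta y * gauss y)))).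
  2: { intros y _. unfold psi, plus, scal; simpl; unfold mult; simpl. ring. }
  rewrite (RInt_plus (V := R_CompleteNormedModule)).
  + rewrite (RInt_scal (V := R_CompleteNormedModule)) by now apply trapezoid_ex_RInt.
    fold (gauss_mass B (trapezoid a b eta)) (gauss_mass B (trapezoid (- A) A eta)). fold I I0.
    unfold plus, scal; simpl; unfold mult; simpl. unfold lam. field. lra.
  + now apply trapezoid_ex_RInt.
  + apply (ex_RInt_scal (V := R_NormedModule)). now apply trapezoid_ex_RInt.
- exists (14 * M + 17 * M' + 8 * L). split.
  { pose proof (HM 0). pose proof (HM' 0). specialize (HL 1 0).
    pose proof (Rabs_pos (F 0)). pose proof (Rabs_pos (0 * F 0 + psi 0)).
    pose proof (Rabs_pos (F 1 - F 0 - (1 - 0) * (1 * F 1 + psi 1))). lra. }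
  intros p q H. pose proof (Ex_W_stein F M M' L psi HM HM' HL p q H) as HS.
  pose proof (joint_law_path_law p q) as Hw.
  assert (E : Ex_W p q (trapezoid a b eta) =
    lam * Ex_W p q (trapezoid (- A) A eta) + Ex_W p q psi).
  { unfold Ex_W. rewrite <- Ex_lin. apply Ex_ext; intros; unfold psi; ring. }
  assert (E1 : Ex_W p q (trapezoid (- A) A eta) <= 1).
  { rewrite <- (Ex_const p q _ 1 Hw). apply Ex_le; [apply (law_ge0 _ _ _ Hw)|].
    intros; apply trapezoid_01. }
  rewrite E. apply Rplus_le_compat; [|exact HS].
  apply Rle_trans with (lam * 1); [apply Rmult_le_compat_l; assumption|lra].
Qed.

(** Chebyshev: the indicator of [P] is at most the trapezoid plus y^2 / A^2. *)
Lemma Ex_W_interval A a b eta (P : R -> Prop) (Pdec : forall y, {P y} + {~ P y}) p q :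
  0 < A -> 0 < eta -> (0 < p + q)%nat ->
  (forall y, P y -> a <= y <= b \/ A <= Rabs y) ->
  Ex_W p q (fun y => if Pdec y then 1 else 0) <= Ex_W p q (trapezoid a b eta) + 16 / A ^ 2.
Proof.
intros A0 e0 H HP. pose proof (joint_law_path_law p q) as Hw.
apply Rle_trans with (/ A ^ 2 * Ex_W p q (fun y => y ^ 2) + Ex_W p q (trapezoid a b eta)).
- unfold Ex_W. rewrite <- Ex_lin. apply Ex_le; [apply (law_ge0 _ _ _ Hw)|]. intros _ x _.
  set (y := (INR x - _) / _).
  pose proof (trapezoid_01 a b eta y) as T.
  assert (Y : 0 <= / A ^ 2 * y ^ 2).
  { apply Rmult_le_pos; [left; apply Rinv_0_lt_compat; nra|apply pow2_ge_0]. }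
  destruct (Pdec y) as [h|h]; [|lra].
  destruct (HP y h) as [h'|h'].
  + rewrite trapezoid_in by auto. lra.
  + assert (1 <= / A ^ 2 * y ^ 2); [|lra].
    apply Rmult_le_reg_l with (A ^ 2); [nra|]. rewrite <- Rmult_assoc, Rinv_r by nra.
    rewrite <- (pow2_abs y). nra.
- pose proof (Ex_W_sq p q H).
  assert (/ A ^ 2 * Ex_W p q (fun y => y ^ 2) <= / A ^ 2 * 16); [|lra].
  apply Rmult_le_compat_l; [left; apply Rinv_0_lt_compat; nra|assumption].
Qed.

(** [K] depends on neither [P] nor [p], [q]. Half of 32 / A^2 is the Chebyshev tail, the other half
    absorbs the division by 1 - 4 / A^2. *)
Lemma interval_bound A a b eta : 3 <= A -> - A <= a -> a <= b -> b <= A -> 0 < eta -> eta <= 1 ->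
  exists K, 0 <= K /\ forall (P : R -> Prop) (Pdec : forall y, {P y} + {~ P y}) p q,
  (0 < p + q)%nat -> (forall y, P y -> a <= y <= b \/ A <= Rabs y) ->
  Ex_W p q (fun y => if Pdec y then 1 else 0) <=
    (Phi (b + eta) - Phi (a - eta)) + 32 / A ^ 2 + K / sqrt (sigma2_pq (INR p) (INR q)).
Proof.
intros A3 Aa ab bA e0 e1.
destruct (trapezoid_bound A a b eta) as (K & K0 & HK); try lra.
exists K; split; [exact K0|]. intros P Pdec p q H HP.
pose proof (Ex_W_interval A a b eta P Pdec p q ltac:(lra) e0 H HP) as H1.
specialize (HK p q H).
pose proof (Phi_01 (b + eta)). pose proof (Phi_01 (a - eta)).
set (d := Phi (b + eta) - Phi (a - eta)) in *.
assert (t : 4 / A ^ 2 <= / 2).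
{ apply Rmult_le_reg_r with (A ^ 2); [nra|]. unfold Rdiv. rewrite Rmult_assoc, Rinv_l; nra. }
assert (t0 : 0 <= 4 / A ^ 2) by (apply Rmult_le_pos; [lra|left; apply Rinv_0_lt_compat; nra]).
replace (32 / A ^ 2) with (8 * (4 / A ^ 2)) by (field; lra).
replace (16 / A ^ 2) with (4 * (4 / A ^ 2)) in H1 by (field; lra).
set (v := 4 / A ^ 2) in *.
assert (d / (1 - v) <= d + 4 * v); [|lra].
apply Rmult_le_reg_r with (1 - v); [lra|]. unfold Rdiv. rewrite Rmult_assoc, Rinv_l by lra.
assert (d1 : d <= 1) by (unfold d; lra).
assert (0 <= v * (4 - d - 4 * v)) by (apply Rmult_le_pos; lra). lra.
Qed.

(* For fixed real c >= 1: along positive integers n with c*n an integer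
   (p = n, q = c n), (X_{p,q} - mu_{p,q}) / sigma_{p,q} converges in
   distribution to N(0,1), i.e. the CDFs converge pointwise to Phi
   (Phi is continuous everywhere). *)
Theorem theorem1p1 (c : R) (hc : 1 <= c) :
  forall x : R, forall eps : R, 0 < eps ->
  exists N : nat, forall n q : nat,
    (N <= n)%nat -> (0 < n)%nat -> INR q = c * INR n ->
    Rabs (cdf_normalized n q (mu_pq (INR n) (INR q))
            (sqrt (sigma2_pq (INR n) (INR q))) x - Phi x) < eps.
Proof.
intros x eps eps0.
set (eta := Rmin 1 (eps / 4)).
assert (e0 : 0 < eta) by (apply Rmin_glb_lt; lra).
assert (e1 : eta <= 1) by apply Rmin_l.
assert (e4 : eta <= eps / 4) by apply Rmin_r.
(* [Rabs x] places x inside [-A, A], 3 meets [interval_bound], and 128 / eps forces 32 / A^2 <= eps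
   / 4. *)
set (A := Rabs x + 3 + 128 / eps).
assert (E128 : 0 < 128 / eps) by (apply Rdiv_lt_0_compat; lra).
pose proof (Rabs_pos x) as x0. pose proof (Rle_abs x) as x1. pose proof (Rle_abs (- x)) as x2.
rewrite Rabs_Ropp in x2.
assert (A3 : 3 <= A) by (unfold A; lra).
assert (Asmall : 32 / A ^ 2 <= eps / 4).
{ apply Rmult_le_reg_r with (A ^ 2); [nra|]. unfold Rdiv at 1. rewrite Rmult_assoc, Rinv_l by nra.
  assert (eps * (128 / eps) = 128) by (field; lra).
  assert (128 <= eps * A) by (unfold A; nra). nra. }
destruct (interval_bound A (- A) x eta) as (K1 & K10 & HK1); try (unfold A; lra).
destruct (interval_bound A x A eta) as (K2 & K20 & HK2); try (unfold A; lra).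
set (K := K1 + K2 + 1).
(* With s^2 >= (n + q) / 8 this makes s exceed 4 K / eps. *)
destruct (INR_unbounded (8 * (4 * K / eps) ^ 2)) as [N HN].
exists N. intros n q Nn n0 _.
assert (H : (0 < n + q)%nat) by lia.
destruct (discriminant_facts n q H) as (N0 & j00 & Hj0 & Hmu & s0 & Hs).
pose proof (s2_ge _ _ N0 j00 _ Hs) as S2.
pose proof (joint_law_path_law n q) as Hw.
specialize (HK1 (fun y => y <= x) (fun y => Rle_dec y x) n q H).
specialize (HK2 (Rlt x) (Rlt_dec x) n q H).
rewrite cdf_Ex.
fold (Ex_W n q (fun y => if Rle_dec y x then 1 else 0)).
(* The lower bound is the upper bound for the complementary event [x < W]. *)
assert (compl : Ex_W n q (fun y => if Rlt_dec x y then 1 else 0)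
   = 1 - Ex_W n q (fun y => if Rle_dec y x then 1 else 0)).
{ transitivity ((-1) * Ex_W n q (fun y => if Rle_dec y x then 1 else 0)
    + Ex (n + q) (joint_law n q) (fun _ _ => 1)).
  - unfold Ex_W. rewrite <- Ex_lin. apply Ex_ext; intros _ k.
    cbv beta. destruct Rle_dec; destruct Rlt_dec; lra.
  - rewrite (Ex_const n q _ 1 Hw). ring. }
rewrite compl in HK2.
set (s := sqrt _) in *.
assert (Ks : K / s < eps / 4).
{ assert (K0 : 0 < K) by (unfold K; lra).
  assert (n1 : INR N <= INR n + INR q).
  { pose proof (le_INR _ _ Nn). pose proof (pos_INR q). lra. }
  assert (c1 : 0 < 4 * K / eps) by (apply Rdiv_lt_0_compat; lra).
  assert (c2 : 4 * K / eps < s) by nra.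
  apply Rmult_lt_reg_r with s; [exact s0|].
  replace (K / s * s) with (eps / 4 * (4 * K / eps)) by (field; lra).
  apply Rmult_lt_compat_l; lra. }
assert (K1s : K1 / s <= K / s) by (apply Rmult_le_compat_r; [left; now apply Rinv_0_lt_compat|unfold K; lra]).
assert (K2s : K2 / s <= K / s) by (apply Rmult_le_compat_r; [left; now apply Rinv_0_lt_compat|unfold K; lra]).
assert (B1 := HK1 ltac:(intros y Hy; destruct (Rle_dec (- A) y); [left; lra|right; rewrite Rabs_left; lra])).
assert (B2 := HK2 ltac:(intros y Hy; destruct (Rle_dec y A); [left; lra|right; rewrite Rabs_pos_eq; lra])).
(* Error budget: [eta], 32 / A^2 and K / s are each at most eps / 4. *)
pose proof (Phi_incr x (x + eta) ltac:(lra)). pose proof (Phi_incr (x - eta) x ltac:(lra)).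
pose proof (Phi_01 (- A - eta)). pose proof (Phi_01 (A + eta)).
apply Rabs_def1; lra.
Qed.
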